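(* Let $n\ge2$. There exists a constant $C_n>0$ depending only on $n$, satisfying $|v_2(x_1,x')|\le C_n\,\underline a(x_1)$ for all $(x_1,x')\in[0,1]\times\overline{B}_1^{n-1}$ (with $v_2$ and $\underline a$ as defined in the context), such that the following holds. Let $\Omega\subset\mathbb{R}^n$ be open, bounded and convex, let $L:\mathbb{R}^n\to\mathbb{R}^n$ be an affine bijection which maps $\Omega$ into $B_1^n$, let $0\le f\in L^1(\Omega)$ with $f\le\Lambda<\infty$, and let $g\in C(\overline\Omega)$ be convex. Let $u\in C(\overline\Omega)$ be the convex solution of $$\mu_u=f\,dx\ \text{ in }\Omega,\qquad u=g\ \text{ on }\partial\Omega.$$ Then the modulus of continuity of $u$ satisfies, for all $\delta>0$, $$\omega_u(\delta)\le\omega_g(\delta)+C_n|\det L|^{-2/n}\Lambda^{1/n}\begin{cases}|L|\delta\,\big(1-\ln(|L|\delta)\big)&\text{for }n=2,\\ (|L|\delta)^{2/n}&\text{otherwise.}\end{cases}$$ Particularly, if $g\in C^{\alpha}(\overline\Omega)$ for some $\alpha\in(0,1)$, then $u\in C^{\min\{\alpha,2/n\}}(\overline\Omega)$.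
   Context: $B_R^k\subset\mathbb{R}^k$ is the ball of radius $R$ around the origin; $|\cdot|$ is the absolute value of a number, the Euclidean norm of a vector, and the Lebesgue measure of a set. For an affine bijection $L$, $|L|$ and $\det L$ denote the spectral norm and the determinant of its linear part. A point $x\in\mathbb{R}^n$ is written $(x_1,x')$ with $x'=(x_2,\dots,x_n)$. For a convex function $u$ on $\Omega$, $\partial u(x)=\{\xi\in\mathbb{R}^n: u(y)\ge u(x)+\langle\xi,y-x\rangle\ \forall y\in\Omega\}$ and the Monge--Ampère measure is $\mu_u(A)=\big|\bigcup_{x\in A}\partial u(x)\big|$ for Borel $A\subset\Omega$. The modulus of continuity of $u:\overline\Omega\to\mathbb{R}$ is $\omega_u(\delta)=\sup\{|u(x)-u(y)|: x,y\in\overline\Omega,\ |x-y|\le\delta\}$. $C^\alpha(\overline\Omega)$ is the space of $\alpha$-Hölder continuous functions on $\overline\Omega$. The function $\underline a$: for $n=2$, $\underline a(t)=t(1-\ln t)$ for $t>0$ and $\underline a(0)=0$; for $n\ge3$, $\underline a(t)=t^{2/n}$. $v_2\in C(\overline K)$ is the convex solution of $\mu_{v_2}=1\,dx$ in $K:=(0,2)\times B_1^{n-1}$, $v_2=0$ on $\partial K$.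
   Formalization: For n=2 the factor |L|δ(1−ln(|L|δ)) is negative when |L|δ>e, making the printed bound false for large δ (e.g. f=g=u=0, Λ=1); it is proved with min(|L|δ,1) in place of |L|δ, i.e. the factor is replaced by 1 when |L|δ>1. *)

(* Defs.v *)
(* MathComp-Analysis *)
From HB Require Import structures.
From mathcomp Require Import all_boot all_order all_algebra.
From mathcomp Require Import all_classical all_reals all_analysis.
Set Implicit Arguments.
Unset Strict Implicit.
Unset Printing Implicit Defensive.
Import Order.TTheory GRing.Theory Num.Theory.
Import numFieldNormedType.Exports.
Local Open Scope classical_set_scope.
Local Open Scope ring_scope.

Section borel_rV.
Context {R : realType} (n : nat).

Let coord (i : 'I_n) (x : 'rV[R]_n) : measurableTypeR R := x ord0 i.

Let rV_set0 : g_sigma_preimage coord set0.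
Proof. exact: sigma_algebra0. Qed.

Let rV_setC A : g_sigma_preimage coord A -> g_sigma_preimage coord (~` A).
Proof. exact: sigma_algebraC. Qed.

Let rV_bigcup (F : (set 'rV[R]_n)^nat) :
  (forall i, g_sigma_preimage coord (F i)) ->
  g_sigma_preimage coord (\bigcup_i (F i)).
Proof. exact: sigma_algebra_bigcup. Qed.

(* The Borel sigma-algebra of R^n, generated by the coordinate functions. *)
HB.instance Definition _ :=
  @isMeasurable.Build default_measure_display 'rV[R]_n
    (g_sigma_preimage coord) rV_set0 rV_setC rV_bigcup.

Lemma measurable_rV_coord (i : 'I_n) :
  measurable_fun [set: 'rV[R]_n]
    (fun x : 'rV[R]_n => x ord0 i : measurableTypeR R).
Proof.
move=> _ Y mY; apply: sub_sigma_algebra => /=.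
by rewrite -bigcup_seq/=; exists i => /=; [rewrite mem_index_enum|exists Y].
Qed.

Lemma measurable_fun_rV d (T : measurableType d) (f : T -> 'rV[R]_n) :
  (forall i, measurable_fun setT (fun t => f t ord0 i : measurableTypeR R)) ->
  measurable_fun setT f.
Proof.
move=> mf _ A mA; rewrite setTI.
suff : preimage_set_system setT f (g_sigma_preimage coord) `<=` measurable.
  by apply; exists A => //; rewrite setTI.
rewrite -g_sigma_preimage_comp; apply: smallest_sub.
  exact: sigma_algebra_measurable.
rewrite -bigcup_seq; apply: bigcup_sub => i _ B [C mC <-].
exact: mf.
Qed.

End borel_rV.

Section lebesgue_rV.
Context {R : realType}.

Definition rV_cons (n : nat) (p : measurableTypeR R * 'rV[R]_n) :
  'rV[R]_n.+1 := row_mx (\row_(_ < 1) p.1) p.2.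

Definition rV_head (n : nat) (x : 'rV[R]_n.+1) : R := x ord0 ord0.

Definition rV_tail (n : nat) (x : 'rV[R]_n.+1) : 'rV[R]_n :=
  \row_(i < n) x ord0 (lift ord0 i).

Lemma rV_consK n : cancel (fun x : 'rV[R]_n.+1 => (rV_head x, rV_tail x))
  (@rV_cons n).
Proof.
move=> x; apply/rowP => i; rewrite /rV_cons mxE; case: splitP => j ij/=.
  by rewrite mxE /rV_head; congr (x _ _); apply/val_inj; rewrite /= ij ord1.
by rewrite mxE; congr (x _ _); apply/val_inj; rewrite /= ij.
Qed.

Lemma rV_headtailK n :
  cancel (@rV_cons n) (fun x : 'rV[R]_n.+1 => (rV_head x, rV_tail x)).
Proof.
move=> [a y]; rewrite /rV_head /rV_tail /rV_cons/=; congr (_, _).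
  by rewrite mxE; case: splitP => j //; rewrite mxE.
apply/rowP => i; rewrite !mxE; case: splitP => j.
  by case: j => -[|j]//= _; rewrite /bump leq0n.
by rewrite /= /bump leq0n => -[ij]; congr (y _ _); apply/val_inj.
Qed.

Lemma measurable_rV_cons n : measurable_fun setT (@rV_cons n).
Proof.
apply: measurable_fun_rV => i; rewrite /rV_cons.
under eq_fun do rewrite mxE.
case: splitP => j ij.
  by under eq_fun do rewrite mxE; exact: measurable_fst.
apply: (measurableT_comp (measurable_rV_coord j)); exact: measurable_snd.
Qed.

Lemma measurable_rV_headtail n :
  measurable_fun setT
    (fun x : 'rV[R]_n.+1 => (rV_head x : measurableTypeR R, rV_tail x)).
Proof.
apply/measurable_fun_pairP; split; first exact: measurable_rV_coord.
apply: measurable_fun_rV => i /=.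
by under eq_fun do rewrite mxE; exact: measurable_rV_coord.
Qed.

Section lebesgue_cons.
Context (n : nat) (mu : {sigma_finite_measure set 'rV[R]_n -> \bar R}).

Definition lebesgue_cons : set 'rV[R]_n.+1 -> \bar R :=
  pushforward (@lebesgue_measure R \x mu)%E (@rV_cons n).

Let lebesgue_cons0 : lebesgue_cons set0 = 0%E.
Proof. by rewrite /lebesgue_cons /pushforward preimage_set0 measure0. Qed.

Let lebesgue_cons_ge0 A : (0 <= lebesgue_cons A)%E.
Proof. exact: (measure_ge0 (@lebesgue_measure R \x mu)%E). Qed.

Let lebesgue_cons_sigma_additive : semi_sigma_additive lebesgue_cons.
Proof.
move=> F mF tF mUF; rewrite /lebesgue_cons /pushforward preimage_bigcup.
apply: measure_semi_sigma_additive.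
- by move=> k; rewrite -[X in measurable X]setTI; exact: measurable_rV_cons.
- apply/trivIsetP => /= i j _ _ ij; rewrite -preimage_setI.
  by move/trivIsetP : tF => /(_ _ _ _ _ ij) ->//; rewrite preimage_set0.
- rewrite -preimage_bigcup -[X in measurable X]setTI.
  exact: measurable_rV_cons.
Qed.

HB.instance Definition _ := isMeasure.Build _ _ _ lebesgue_cons
  lebesgue_cons0 lebesgue_cons_ge0 lebesgue_cons_sigma_additive.

Let lebesgue_cons_sigma_finite : sigma_finite setT lebesgue_cons.
Proof.
have [F FT Foo] : sigma_finite setT (@lebesgue_measure R \x mu)%E.
  have /sigma_finiteP[F [TF ndF Foo]] := sigma_finiteT (@lebesgue_measure R).
  have /sigma_finiteP[G [TG ndG Goo]] := sigma_finiteT mu.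
  exists (fun k => F k `*` G k).
    rewrite -setXTT TF TG predeqE => -[x y]; split.
      move=> [/= [k _ Fkx] [l _ Gly]]; exists (maxn k l) => //; split.
      - by move: x Fkx; exact/subsetPset/ndF/leq_maxl.
      - by move: y Gly; exact/subsetPset/ndG/leq_maxr.
    by move=> [k _ []/= ? ?]; split; exists k.
  move=> k; have [? ?] := Foo k; have [? ?] := Goo k.
  split; first exact: measurableX.
  by rewrite product_measure1E// lte_mul_pinfty// ge0_fin_numE.
pose ht := fun x : 'rV[R]_n.+1 => (rV_head x : measurableTypeR R, rV_tail x).
exists (fun k => ht @^-1` F k) => [|k].
  by rewrite -preimage_bigcup -FT preimage_setT.
have [mF Fk] := Foo k; split.
  by rewrite -[X in measurable X]setTI; exact: measurable_rV_headtail.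
rewrite /lebesgue_cons /pushforward -comp_preimage.
rewrite (_ : ht \o _ = id) ?preimage_id//.
by apply/funext => p; exact: rV_headtailK.
Qed.

HB.instance Definition _ := Measure_isSigmaFinite.Build _ _ _ lebesgue_cons
  lebesgue_cons_sigma_finite.

End lebesgue_cons.

(* Lebesgue measure on the Borel subsets of R^n: the unit mass on the point
   R^0, then R^(n+1) = R x R^n with the product measure. *)
Fixpoint lebesgue_rV (n : nat) : {sigma_finite_measure set 'rV[R]_n -> \bar R} :=
  if n is n'.+1 then lebesgue_cons (lebesgue_rV n') else \d_(0 : 'rV[R]_0).

(* |A| for an arbitrary A: the Lebesgue outer measure, which is the (completed)
   Lebesgue measure when A is Lebesgue measurable. *)
Definition vol (n : nat) (A : set 'rV[R]_n) : \bar R := mu_ext (lebesgue_rV n) A.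

End lebesgue_rV.

Section euclidean.
Context {R : realType}.

Definition dotv (n : nat) (x y : 'rV[R]_n) : R :=
  \sum_(i < n) x ord0 i * y ord0 i.

(* The library norm on 'rV[R]_n is the sup norm (with the same topology). *)
Definition enorm (n : nat) (x : 'rV[R]_n) : R := Num.sqrt (dotv x x).

(* Vectors are rows, so the matrix A acts by x |-> x *m A. *)
Definition specnorm (n : nat) (A : 'M[R]_n) : R :=
  sup [set enorm (x *m A) | x in [set x : 'rV[R]_n | enorm x <= 1]].

(* Extended-real valued, so that no boundedness convention is involved. *)
Definition modulus (n : nat) (Omega : set 'rV[R]_n) (u : 'rV[R]_n -> R)
    (delta : R) : \bar R :=
  ereal_sup [set e | exists x y : 'rV[R]_n,
    [/\ closure Omega x, closure Omega y, enorm (x - y) <= delta &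
        e = `|u x - u y|%:E]].

Definition holder (n : nat) (Omega : set 'rV[R]_n) (alpha : R)
    (u : 'rV[R]_n -> R) : Prop :=
  exists H : R, forall x y : 'rV[R]_n, closure Omega x -> closure Omega y ->
    `|u x - u y| <= H * enorm (x - y) `^ alpha.

End euclidean.

Section monge_ampere.
Context {R : realType}.

Definition subdiff (n : nat) (Omega : set 'rV[R]_n) (u : 'rV[R]_n -> R)
    (x : 'rV[R]_n) : set 'rV[R]_n :=
  [set xi | forall y, Omega y -> u x + dotv xi (y - x) <= u y].

Definition MA_measure (n : nat) (Omega : set 'rV[R]_n) (u : 'rV[R]_n -> R)
    (A : set 'rV[R]_n) : \bar R :=
  vol (\bigcup_(x in A) subdiff Omega u x).

(* u is a convex solution, continuous on the closure of Omega, of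
   mu_u = f dx in Omega, u = g on the boundary of Omega (Omega is open, so its
   boundary is its closure minus Omega). Functions are total; only their values
   on closure Omega matter. *)
Definition MA_solution (n : nat) (Omega : set 'rV[R]_n)
    (f g u : 'rV[R]_n -> R) : Prop :=
  [/\ {within closure Omega, continuous u},
      convex_function Omega u,
      (forall A : set 'rV[R]_n, measurable A -> A `<=` Omega ->
         (MA_measure Omega u A = \int[lebesgue_rV n]_(x in A) (f x)%:E)%E) &
      (forall x, closure Omega x -> ~ Omega x -> u x = g x)].

(* The cylinder (0,2) x B_1^n in dimension n.+1. *)
Definition cylinder (n : nat) : set 'rV[R]_n.+1 :=
  [set x | 0 < rV_head x < 2 /\ enorm (rV_tail x) < 1].

Definition a_low (n : nat) (t : R) : R :=
  if n == 2%N then (if t == 0 then 0 else t * (1 - ln t))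
  else t `^ (2 / n%:R).

End monge_ampere.

Arguments cylinder {R} n _.

(* Main.v *)
(** A convex function which is bounded below by a paraboloid touching it at an
    interior point x0, strictly away from x0, has Monge-Ampere density at least
    the determinant of the Hessian of the paraboloid near x0: the gradients of
    the lifted paraboloid at the points where it lies above u are subgradients
    of u. Hence u >= g + Q for every quadratic polynomial Q with large enough
    Hessian determinant that is nonpositive on the boundary. After normalising
    Omega into the unit ball, let s be the distance to a supporting hyperplane.
    Applying this on the slabs {s <= h}, with Q anisotropic and adapted to the
    scale h, turns the bound u >= g - m(8 t) on {s <= 8 t} into
    u >= g - c t^(2/n) - m(8 t) / 8 on {s <= t}. Iterating gives u >= g - C s^(2/n)
    for n >= 3, while for n = 2 the contributions of all scales are equal and
    produce the logarithm. Finally, by convexity of u along lines, the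
    oscillation of u over a segment is largest when the segment ends on the
    boundary, where u = g. *)
Require Import Defs.
From mathcomp Require Import all_boot all_order all_algebra.
From mathcomp Require Import all_classical all_reals all_analysis.
From mathcomp Require Import measurable_realfun.
From mathcomp Require Import ring lra.
Set Implicit Arguments.
Unset Strict Implicit.
Unset Printing Implicit Defensive.
Import Order.TTheory GRing.Theory Num.Theory.
Import numFieldNormedType.Exports.
Local Open Scope classical_set_scope.
Local Open Scope ring_scope.

(** * Lebesgue measure and linear maps *)

Section lebesgue_affine.
Context {R : realType}.

(** The gradient map of a paraboloid is affine, so the only volume formula needed for a set of
    subgradients is the one for invertible matrices. Let the Hessian of Q have size kappa along the
    hyperplane and j across it, with kappa^(n-1) j = 1. At height t in a slab of width h = 8 t it
    costs about kappa + j t h, and the two terms balance for kappa = t^(2/n), j = t^(2/n - 2). An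
    error m on the far face s = h enters through the linear function - m s / h, hence as m / 8 at
    height t. A bound C t^(2/n) at scale 8 t is therefore passed on with the factor 8^(2/n) / 8.
    This is at most 1/2 for n >= 3, so the errors sum to a multiple of t^(2/n); it is 1 for n = 2,
    where about ln(1/t) scales contribute a term of order t each. The bound on v_2 is another
    instance of the same estimate: the domain is the cylinder, g = 0 and s = x_1. *)

Lemma measurable_affine (a b : R) :
  measurable_fun setT
    ((fun x => a * x + b) : measurableTypeR R -> measurableTypeR R).
Proof. by apply: measurable_funD => //; exact: mulrl_measurable. Qed.

(** A measure that gives every interval []x, y]] its length is Lebesgue measure. For [a < 0] the
    preimage of such an interval is closed on the left and open on the right, which does not affect
    its length. *)
Lemma lebesgue_measure_affine (a b : R) (A : set (measurableTypeR R)) :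
  a != 0 -> measurable A ->
  (lebesgue_measure A =
   `|a|%:E * lebesgue_measure ((fun x => a * x + b)%R @^-1` A))%E.
Proof.
move=> a0 mA.
apply: (lebesgue_measure_unique (mu := mscale (NngNum (normr_ge0 a))
    (pushforward (@lebesgue_measure R)
  ((fun x => a * x + b) : measurableTypeR R -> measurableTypeR R)))) => //.
  exact: measurable_affine.
move=> mf X /ocitvP[->|[[x y]/= xy ->]].
  by rewrite !measure0.
rewrite /mscale /= /pushforward lebesgue_measure_itv/= lte_fin xy.
have [a_gt0|a_lt0|a_eq0] := ltgtP 0 a; last by rewrite -a_eq0 eqxx in a0.
  rewrite (_ : _ @^-1` _ = `](x - b) / a, (y - b) / a]%classic); last first.
    apply/seteqP; split => z /=; rewrite !in_itv/=;
      by rewrite ltr_pdivrMr// ler_pdivlMr// ltrBlDr lerBrDr [z * a]mulrC.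
  rewrite lebesgue_measure_itv/= lte_fin ltr_pM2r ?invr_gt0// ltrD2r xy.
  by rewrite -!EFinB -EFinM gtr0_norm//; congr EFin; field.
rewrite (_ : _ @^-1` _ = `[(y - b) / a, (x - b) / a[%classic); last first.
  apply/seteqP; split => z /=; rewrite !in_itv/=;
    by rewrite ltr_ndivlMr// ler_ndivrMr// ltrBlDr lerBrDr [z * a]mulrC andbC.
rewrite lebesgue_measure_itv/= lte_fin ltr_nM2r ?invr_lt0// ltrD2r xy.
by rewrite -!EFinB -EFinM ltr0_norm//; congr EFin; field.
Qed.

End lebesgue_affine.

Section product_fiber.
Context d1 d2 (T1 : measurableType d1) (T2 : measurableType d2) (R : realType).
Context (m1 : {sigma_finite_measure set T1 -> \bar R}).
Context (m2 : {sigma_finite_measure set T2 -> \bar R}).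
Local Open Scope ereal_scope.

(** Integrate the measures of the sections: each is rescaled by the same factor [c]. Shears and
    block diagonal matrices are treated in this way, one block of coordinates at a time. *)
Lemma product_measure_fiber2 (c : R) (phi : T1 -> T2 -> T2) (A : set (T1 * T2)) :
  (0 <= c)%R ->
  measurable_fun setT (fun p : T1 * T2 => (p.1, phi p.1 p.2)) ->
  (forall x B, measurable B -> m2 B = c%:E * m2 (phi x @^-1` B)) ->
  measurable A ->
  (m1 \x m2) A =
    c%:E * (m1 \x m2) ((fun p : T1 * T2 => (p.1, phi p.1 p.2)) @^-1` A).
Proof.
move=> c0 mphi phiE mA.
set A' := _ @^-1` A.
have mA' : measurable A' by rewrite -[A']setTI; exact: mphi.
rewrite /product_measure1 -ge0_integralZl//; last first.
  exact: measurable_fun_xsection.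
apply: eq_integral => x _ /=.
by rewrite (phiE x) /xsection; last exact: measurable_xsection.
Qed.

(** The order of integration is exchanged by uniqueness of the product measure. *)
Lemma product_measure_fiber1 (c : R) (phi : T2 -> T1 -> T1) (A : set (T1 * T2)) :
  (0 <= c)%R ->
  measurable_fun setT (fun p : T1 * T2 => (phi p.2 p.1, p.2)) ->
  (forall y B, measurable B -> m1 B = c%:E * m1 (phi y @^-1` B)) ->
  measurable A ->
  (m1 \x m2) A =
    c%:E * (m1 \x m2) ((fun p : T1 * T2 => (phi p.2 p.1, p.2)) @^-1` A).
Proof.
move=> c0 mphi phiE mA.
set A' := _ @^-1` A.
have mA' : measurable A' by rewrite -[A']setTI; exact: mphi.
have E B : measurable B -> (m1 \x m2) B = (m1 \x^ m2) B.
  by apply: product_measure_unique => //= *; rewrite product_measure2E.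
rewrite !E// /product_measure2 -ge0_integralZl//; last first.
  exact: measurable_fun_ysection.
apply: eq_integral => y _ /=.
by rewrite (phiE y) /ysection; last exact: measurable_ysection.
Qed.

End product_fiber.

Section lebesgue_rV_affine.
Context {R : realType}.

Lemma measurable_mulmx_add m n (M : 'M[R]_(m, n)) (b : 'rV[R]_n) :
  measurable_fun setT (fun x : 'rV[R]_m => x *m M + b).
Proof.
apply: measurable_fun_rV => i.
under eq_fun do rewrite mxE mxE.
apply: measurable_funD => //.
apply: (@measurable_sum _ _ R) => j.
apply: measurable_funM => //; exact: (measurable_rV_coord j).
Qed.

Lemma rV_consE n (x : R) (y : 'rV[R]_n) :
  rV_cons (x, y) = row_mx (x%:M : 'rV_1) y.
Proof.
rewrite /rV_cons/=; have -> : \row_(_ < 1) x = x%:M :> 'rV[R]_1; last by []; apply/rowP => i.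
by rewrite !mxE !ord1 eqxx mulr1n.
Qed.

Lemma rV_cons_add n (x x' : R) (y y' : 'rV[R]_n) :
  rV_cons (x, y) + rV_cons (x', y') = rV_cons (x + x', y + y').
Proof. by rewrite !rV_consE raddfD/= -add_row_mx. Qed.

Lemma lebesgue_rV_consE n (A : set 'rV[R]_n.+1) :
  lebesgue_rV n.+1 A =
  (@lebesgue_measure R \x lebesgue_rV n)%E (@rV_cons R n @^-1` A).
Proof. by []. Qed.

Lemma measurable_rV_cons_preimage n (A : set 'rV[R]_n.+1) :
  measurable A -> measurable (@rV_cons R n @^-1` A).
Proof. by move=> mA; rewrite -[_ @^-1` _]setTI; exact: measurable_rV_cons. Qed.

Lemma measurable_pair_map d1 d2 (T1 : measurableType d1) (T2 : measurableType d2)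
    (phi : T1 * T2 -> T1) (psi : T1 * T2 -> T2) :
  measurable_fun setT phi -> measurable_fun setT psi ->
  measurable_fun setT (fun p => (phi p, psi p)).
Proof. by move=> mphi mpsi; apply/measurable_fun_pairP; split. Qed.

(** Needed for shears, which translate each section by an amount depending on the section. *)
Lemma lebesgue_rV_translate n (b : 'rV[R]_n) (A : set 'rV[R]_n) :
  measurable A -> lebesgue_rV n A = lebesgue_rV n ((fun x => x + b) @^-1` A).
Proof.
elim: n b A => [b A _|n IH b A mA].
  by rewrite (_ : _ @^-1` _ = A)//; apply/seteqP; split => x/=;
    rewrite [x + b]thinmx0 [x]thinmx0.
have [b1 [b2 ->]] : exists b1 b2, b = rV_cons (b1, b2).
  by exists (rV_head b), (rV_tail b); rewrite (rV_consK b).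
rewrite !lebesgue_rV_consE.
have mA' := measurable_rV_cons_preimage mA.
rewrite (@product_measure_fiber2 _ _ _ _ R _ _ 1
  (fun (_ : measurableTypeR R) (y : 'rV[R]_n) => y + b2)) => //.
- rewrite mul1e.
  set B := _ @^-1` _.
  rewrite (@product_measure_fiber1 _ _ _ _ R _ _ 1
    (fun (_ : 'rV[R]_n) (x : measurableTypeR R) => x + b1)) => //.
  + rewrite mul1e; congr product_measure1; apply/seteqP; split => -[x y]/=;
      by rewrite rV_cons_add.
  + apply: measurable_pair_map => //.
    by apply: measurable_funD => //; exact: measurable_fst.
  + move=> _ C mC; apply: (etrans (lebesgue_measure_affine b1 (oner_neq0 _) mC)).
    by rewrite normr1; under eq_fun do rewrite mul1r.
  + rewrite -[B]setTI; apply: measurable_pair_map => //.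
    apply: (measurableT_comp (f := fun y : 'rV[R]_n => y + b2)) => //.
    by have := measurable_mulmx_add 1%:M b2; under eq_fun do rewrite mulmx1.
- apply: measurable_pair_map => //.
  apply: (measurableT_comp (f := fun y : 'rV[R]_n => y + b2)) => //.
  by have := measurable_mulmx_add 1%:M b2; under eq_fun do rewrite mulmx1.
- by move=> _ B mB; rewrite mul1e -IH.
Qed.

End lebesgue_rV_affine.

Section lebesgue_rV_linear.
Context {R : realType}.

(** Stated with the preimage, which is measurable whenever [A] is; in this form the property passes
    to products of matrices. *)
Definition scales_lebesgue n (M : 'M[R]_n) := forall A : set 'rV[R]_n,
  measurable A ->
  lebesgue_rV n A =
    (`|\det M|%:E * lebesgue_rV n ((fun x => x *m M) @^-1` A))%E.

Lemma measurable_mulmxr m n (M : 'M[R]_(m, n)) :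
  measurable_fun setT (fun x : 'rV[R]_m => x *m M).
Proof.
by have := measurable_mulmx_add M 0; under eq_fun do rewrite addr0.
Qed.

Lemma scales_lebesgue_mul n (M N : 'M[R]_n) :
  scales_lebesgue M -> scales_lebesgue N -> scales_lebesgue (M *m N).
Proof.
move=> sM sN A mA; rewrite sN// sM; last first.
  by rewrite -[X in measurable X]setTI; exact: measurable_mulmxr.
rewrite det_mulmx normrM mulrC EFinM muleA.
by congr (_ * lebesgue_rV n _)%E; apply/seteqP; split => x/=; rewrite mulmxA.
Qed.

Lemma rV_cons_mul_block n (x : R) (y : 'rV[R]_n) a b c (d : 'M[R]_n) :
  rV_cons (x, y) *m block_mx (a : 'M[R]_1) b c d =
  rV_cons (x * a ord0 ord0 + (y *m c) ord0 ord0, x *: b + y *m d).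
Proof.
rewrite !rV_consE [LHS](mul_row_block (x%:M) y a b c d).
rewrite !mul_scalar_mx.
suff -> : x *: a + y *m c = (x * a ord0 ord0 + (y *m c) ord0 ord0)%:M by [].
by apply/rowP => i; rewrite mxE ord1 [RHS]mxE eqxx mulr1n mxE.
Qed.

Lemma scales_lebesgue_upper n (b : 'rV[R]_n) :
  scales_lebesgue (block_mx 1%:M b 0 1%:M : 'M[R]_(1 + n)).
Proof.
move=> A mA; rewrite det_ublock !det1 mulr1 normr1.
rewrite !(@lebesgue_rV_consE R n).
rewrite (@product_measure_fiber2 _ _ _ _ R _ _ 1
  (fun (x : measurableTypeR R) (y : 'rV[R]_n) => x *: b + y)) //.
- congr (_ * product_measure1 _ _ _)%E; apply/seteqP; split => -[x y]/=;
    by rewrite rV_cons_mul_block mulmx0 mulmx1 [fun_of_matrix 1%:M _ _]mxE eqxx mulr1n mulr1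
      [fun_of_matrix 0 _ _]mxE addr0.
- apply: measurable_pair_map => //; apply: measurable_fun_rV => i.
  under eq_fun do rewrite !mxE.
  apply: measurable_funD => //.
    by apply: measurable_funM => //; exact: measurable_fst.
  apply: (measurableT_comp (measurable_rV_coord i)); exact: measurable_snd.
- move=> x B mB; rewrite mul1e (lebesgue_rV_translate (x *: b))//.
  by under eq_fun do rewrite addrC.
- exact: measurable_rV_cons_preimage.
Qed.

Lemma scales_lebesgue_lower n (c : 'cV[R]_n) :
  scales_lebesgue (block_mx 1%:M 0 c 1%:M : 'M[R]_(1 + n)).
Proof.
move=> A mA; rewrite det_lblock !det1 mulr1 normr1.
rewrite !(@lebesgue_rV_consE R n).
rewrite (@product_measure_fiber1 _ _ _ _ R _ _ 1
  (fun (y : 'rV[R]_n) (x : measurableTypeR R) => x + (y *m c) ord0 ord0)) //.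
- congr (_ * product_measure1 _ _ _)%E; apply/seteqP; split => -[x y]/=;
    by rewrite rV_cons_mul_block scaler0 mulmx1 [fun_of_matrix 1%:M _ _]mxE eqxx mulr1n mulr1
      add0r.
- apply: measurable_pair_map => //; apply: measurable_funD => //.
  apply: (measurableT_comp (measurable_rV_coord ord0)).
  apply: (measurableT_comp (measurable_mulmxr c)); exact: measurable_snd.
- move=> y B mB.
  apply: (etrans (lebesgue_measure_affine ((y *m c) ord0 ord0) (oner_neq0 _) mB)).
  by rewrite normr1; under eq_fun do rewrite mul1r.
- exact: measurable_rV_cons_preimage.
Qed.

Lemma scales_lebesgue_diag n (a : R) (S : 'M[R]_n) : a != 0 ->
  scales_lebesgue S ->
  scales_lebesgue (block_mx a%:M 0 0 S : 'M[R]_(1 + n)).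
Proof.
move=> a0 sS A mA; rewrite det_ublock det_scalar1 normrM.
rewrite !(@lebesgue_rV_consE R n).
have mA' := measurable_rV_cons_preimage mA.
rewrite (@product_measure_fiber1 _ _ _ _ R _ _ `|a|
  (fun (y : 'rV[R]_n) (x : measurableTypeR R) => a * x)) //.
- rewrite EFinM -muleA; congr (_ * _)%E.
  rewrite (@product_measure_fiber2 _ _ _ _ R _ _ `|\det S|
    (fun (x : measurableTypeR R) (y : 'rV[R]_n) => y *m S)) //.
  + congr (_ * product_measure1 _ _ _)%E; apply/seteqP; split => -[x y]/=;
      by rewrite rV_cons_mul_block scaler0 mulmx0 [fun_of_matrix 0 _ _]mxE addr0 add0r
        [fun_of_matrix a%:M _ _]mxE eqxx mulr1n mulrC.
  + apply: measurable_pair_map => //.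
    apply: (measurableT_comp (measurable_mulmxr S)); exact: measurable_snd.
  + rewrite -[X in measurable X]setTI; apply: measurable_pair_map => //.
    by apply: measurable_funM => //; exact: measurable_fst.
- apply: measurable_pair_map => //.
  by apply: measurable_funM => //; exact: measurable_fst.
- move=> y B mB.
  apply: (etrans (lebesgue_measure_affine 0 a0 mB)).
  by under eq_fun do rewrite addr0.
Qed.

(* Block Gaussian elimination: M is a product of shears and of a block diagonal
   matrix, after a shear that makes the pivot nonzero. *)
Lemma lebesgue_rV_mulmx n (M : 'M[R]_n) : M \in unitmx -> scales_lebesgue M.
Proof.
elim: n M => [M _ A mA|n IH M uM].
  rewrite det_mx00 normr1 mul1e; congr (lebesgue_rV 0 _).
  by apply/seteqP; split => x/=; rewrite [x]thinmx0 mul0mx.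
have pivot (a : R) b c (d : 'M[R]_n) : a != 0 ->
    (block_mx a%:M b c d : 'M[R]_(1 + n)) \in unitmx ->
    scales_lebesgue (block_mx a%:M b c d : 'M[R]_(1 + n)).
  (* [S] is the Schur complement of the pivot [a]; the block diagonal factor carries the
     determinant. *)
  move=> a0; set S := d - a^-1 *: (c *m b).
  have -> : (block_mx a%:M b c d : 'M[R]_(1 + n)) =
     block_mx 1%:M 0 (a^-1 *: c) 1%:M *m block_mx a%:M 0 0 S *m
       block_mx 1%:M (a^-1 *: b) 0 1%:M.
    rewrite !mulmx_block !mul1mx !mulmx1 !mul0mx !mulmx0 !addr0 !add0r.
    rewrite -!scalemxAl -!scalemxAr mul_mx_scalar mul_scalar_mx !scalerA.
    by rewrite -scalemxAl scalerA -mulrA !mulVf// mulr1 !scale1r /S addrC subrK.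
  rewrite !unitmx_mul => /andP[/andP[_ uS] _].
  apply: scales_lebesgue_mul; last exact: scales_lebesgue_upper.
  apply: scales_lebesgue_mul; first exact: scales_lebesgue_lower.
  apply: scales_lebesgue_diag => //; apply: IH.
  by move: uS; rewrite !unitmxE det_ublock unitrM => /andP[].
move: uM; rewrite -[M](@submxK _ 1 n 1 n).
set b := ursubmx _; set c := dlsubmx _; set d := drsubmx _.
rewrite [ulsubmx _]mx11_scalar; set a := ulsubmx _ _ _.
have [a0 uM|] := eqVneq a 0; last exact: pivot.
have [c0|c0] := eqVneq c 0.
  move: uM; rewrite a0 c0 unitmxE (@det_ublock _ 1 n) det_scalar1 mul0r.
  by rewrite unitr0.
have /rV0Pn[i ci] : c^T != 0.
  by apply: contra c0 => /eqP/(congr1 trmx); rewrite trmxK trmx0 => ->.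
(* Adding row [i] of the lower blocks to the first row turns the zero pivot into [c i ord0]; [E]
   lets this shear be undone on the left. *)
pose e : 'rV[R]_n := delta_mx ord0 i.
have ec : e *m c = (c i ord0)%:M.
  by rewrite -rowE; apply/matrixP => j k; rewrite !ord1 !mxE eqxx mulr1n.
have E : block_mx 1%:M (- e) 0 1%:M *m block_mx 1%:M e 0 1%:M = 1%:M :> 'M[R]_(1 + n).
  rewrite mulmx_block !mul1mx !mulmx1 !mul0mx !mulmx0 !addr0 !add0r subrr.
  by rewrite -scalar_mx_block.
rewrite -[block_mx _ _ _ _]mul1mx -E -mulmxA.
apply: scales_lebesgue_mul; first exact: scales_lebesgue_upper.
have uN : (block_mx 1%:M e 0 1%:M : 'M[R]_(1 + n)) \in unitmx.
  by rewrite unitmxE det_ublock !det1 mulr1 unitr1.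
have : block_mx 1%:M e 0 1%:M *m block_mx a%:M b c d \in unitmx.
  by rewrite unitmx_mul uN.
rewrite mulmx_block !mul1mx !mul0mx !add0r ec a0 raddf0 add0r.
by apply: pivot; rewrite mxE in ci.
Qed.

End lebesgue_rV_linear.

(** * Open sets and balls of R^n *)

Section lebesgue_rV_topology.
Context {R : realType}.

Lemma ball_rVP n (x y : 'rV[R]_n) (r : R) :
  ball x r y <-> 0 < r /\ forall i, `|x ord0 i - y ord0 i| < r.
Proof.
split=> -[r0 xy]; split => // i; first exact: (xy ord0 i).
by move=> j; rewrite (ord1 i); exact: xy.
Qed.

Lemma measurable_ball_rV n (x : 'rV[R]_n) (r : R) : measurable (ball x r).
Proof.
have [r0|r0] := leP r 0.
  rewrite (_ : ball x r = set0)//; apply/seteqP; split => y //= /ball_rVP[].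
  by rewrite ltNge r0.
rewrite (_ : ball x r = \bigcap_(i in [set: 'I_n])
   ((fun y : 'rV[R]_n => y ord0 i) @^-1` ball (x ord0 i) r)).
  apply: fin_bigcap_measurable => // i _.
  rewrite -[X in measurable X]setTI; apply: measurable_rV_coord => //.
  exact: measurable_ball.
apply/seteqP; split => y; first by move=> /ball_rVP[_ xy] i _; exact: xy.
by move=> xy; apply/ball_rVP; split => // i; exact: xy.
Qed.

Lemma rV_cons_head n (a : R) (y : 'rV[R]_n) : rV_head (rV_cons (a, y)) = a.
Proof. by have [] := rV_headtailK (a, y). Qed.

Lemma rV_cons_tail n (a : R) (y : 'rV[R]_n) : rV_tail (rV_cons (a, y)) = y.
Proof. by have [] := rV_headtailK (a, y). Qed.

Lemma ball_rV_headtail n (x y : 'rV[R]_n.+1) (r : R) :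
  ball x r y <-> ball (rV_head x) r (rV_head y) /\ ball (rV_tail x) r (rV_tail y).
Proof.
split=> [/ball_rVP[r0 xy]|[xy1 /ball_rVP[r0 xy2]]].
  split; first exact: xy.
  by apply/ball_rVP; split => // i; rewrite !mxE; exact: xy.
apply/ball_rVP; split => // i; case: (unliftP ord0 i) => [j|] ->; last exact: xy1.
by have := xy2 j; rewrite !mxE.
Qed.

(** The balls are those of the sup norm: cubes of side [2 r], each the product of an interval and a
    cube of one dimension less. *)
Lemma lebesgue_rV_ball n (x : 'rV[R]_n) (r : R) : 0 < r ->
  lebesgue_rV n (ball x r) = ((r *+ 2) ^+ n)%:E.
Proof.
move=> r0; elim: n x => [x|n IH x].
  rewrite expr0 /= diracE mem_set//; apply/ball_rVP; split => //.
  by case.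
rewrite lebesgue_rV_consE.
rewrite (_ : _ @^-1` _ = ball (rV_head x) r `*` ball (rV_tail x) r); last first.
  apply/seteqP; split => -[a y]; rewrite /preimage/= ball_rV_headtail.
    by rewrite (rV_cons_head a y) (rV_cons_tail a y).
  by rewrite (rV_cons_head a y) (rV_cons_tail a y).
rewrite product_measure1E//=; [|exact: measurable_ball|exact: measurable_ball_rV].
by rewrite lebesgue_measure_ball ?ltW// IH exprS EFinM.
Qed.

(** The sigma-algebra is generated by the coordinates, so an open set is written as a countable
    union of cubes with rational centre and radius. *)
Lemma open_measurable_rV n (U : set 'rV[R]_n) : open U -> measurable U.
Proof.
move=> oU.
pose I := {p : 'rV[rat]_n * rat | ball (map_mx ratr p.1 : 'rV[R]_n) (ratr p.2) `<=` U}.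
rewrite (_ : U = \bigcup_(i in [set: I])
    ball (map_mx ratr (sval i).1 : 'rV[R]_n) (ratr (sval i).2)); last first.
  apply/seteqP; split => [x Ux|x [[p pU]] _ /=]; last exact: pU.
  have /nbhs_ballP[e/= e0 xeU] : nbhs x U by exact: open_nbhs_nbhs.
  have [q] := @rat_in_itvoo R (e / 4) (e / 2) ltac:(lra).
  rewrite in_itv/= => /andP[q1 q2].
  have q0 : 0 < ratr q :> R by lra.
  have /choice[y yx] : forall i, exists y : rat, `|ratr y - x ord0 i| < ratr q.
    move=> i; have [y] := @rat_in_itvoo R (x ord0 i - ratr q) (x ord0 i + ratr q) ltac:(lra).
    by rewrite in_itv/= => ?; exists y; rewrite ltr_distl.
  have yxq : ball (map_mx ratr (\row_i y i) : 'rV[R]_n) (ratr q) x.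
    by apply/ball_rVP; split => // i; rewrite !mxE.
  have pU : ball (map_mx ratr (\row_i y i) : 'rV[R]_n) (ratr q) `<=` U.
    move=> z yz; apply: xeU; rewrite [e]splitr; apply: (ball_triangle _ _).
    - by apply: le_ball (ltW q2) _ _; exact/ball_sym/yxq.
    - by apply: le_ball (ltW q2) _ yz.
  by exists (exist _ (\row_i y i, q) pU).
apply: countable_bigcupT_measurable => [|i]; last exact: measurable_ball_rV.
apply/countable_injP; exists (fun i : I => pickle (sval i)) => -[p pU] [q qU] _ _ /=.
move=> /(pcan_inj pickleK) pq; apply: eq_exist.
by rewrite pq in pU *.
Qed.

Lemma lebesgue_rV_open_gt0 n (U : set 'rV[R]_n) x :
  open U -> U x -> (0 < lebesgue_rV n U)%E.
Proof.
move=> oU Ux; have /nbhs_ballP[r/= r0 xrU] : nbhs x U by exact: open_nbhs_nbhs.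
apply: (@lt_le_trans _ _ (lebesgue_rV n (ball x r))).
  by rewrite lebesgue_rV_ball// lte_fin exprn_gt0// mulr2n addr_gt0.
by apply: le_measure; rewrite ?inE//;
  [exact: measurable_ball_rV|exact: open_measurable_rV].
Qed.

Lemma lebesgue_rV_bounded_lty n (U : set 'rV[R]_n) x r :
  measurable U -> U `<=` ball x r -> (lebesgue_rV n U < +oo)%E.
Proof.
move=> mU Ur; have [r0|r0] := leP r 0.
  rewrite (_ : U = set0) ?measure0//; apply/seteqP; split => y // /Ur/ball_rVP[].
  by rewrite ltNge r0.
apply: (@le_lt_trans _ _ (lebesgue_rV n (ball x r))).
  by apply: le_measure; rewrite ?inE//; exact: measurable_ball_rV.
by rewrite lebesgue_rV_ball// ltry.
Qed.

End lebesgue_rV_topology.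

(** * Euclidean geometry and convexity *)

Section dotv.
Context {R : realType}.
Implicit Types n : nat.

Lemma dotvE n (x y : 'rV[R]_n) : dotv x y = (x *m y^T) ord0 ord0.
Proof. by rewrite mxE; apply: eq_bigr => i _; rewrite mxE. Qed.

Lemma dotvC n (x y : 'rV[R]_n) : dotv x y = dotv y x.
Proof. by apply: eq_bigr => i _; rewrite mulrC. Qed.

Lemma dotvDl n (x y z : 'rV[R]_n) : dotv (x + y) z = dotv x z + dotv y z.
Proof. by rewrite !dotvE mulmxDl mxE. Qed.

Lemma dotvDr n (x y z : 'rV[R]_n) : dotv z (x + y) = dotv z x + dotv z y.
Proof. by rewrite !(dotvC z) dotvDl. Qed.

Lemma dotvZl n a (x z : 'rV[R]_n) : dotv (a *: x) z = a * dotv x z.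
Proof. by rewrite !dotvE -scalemxAl mxE. Qed.

Lemma dotvZr n a (x z : 'rV[R]_n) : dotv z (a *: x) = a * dotv z x.
Proof. by rewrite !(dotvC z) dotvZl. Qed.

Lemma dotvNl n (x z : 'rV[R]_n) : dotv (- x) z = - dotv x z.
Proof. by rewrite -scaleN1r dotvZl mulN1r. Qed.

Lemma dotvNr n (x z : 'rV[R]_n) : dotv z (- x) = - dotv z x.
Proof. by rewrite !(dotvC z) dotvNl. Qed.

Lemma dotvBl n (x y z : 'rV[R]_n) : dotv (x - y) z = dotv x z - dotv y z.
Proof. by rewrite dotvDl dotvNl. Qed.

Lemma dotvBr n (x y z : 'rV[R]_n) : dotv z (x - y) = dotv z x - dotv z y.
Proof. by rewrite dotvDr dotvNr. Qed.

Lemma dotv0l n (z : 'rV[R]_n) : dotv 0 z = 0.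
Proof. by rewrite -(scale0r 0) dotvZl mul0r. Qed.

Lemma dotv_mulmx m n (M : 'M[R]_(m, n)) (x : 'rV_m) (y : 'rV_n) :
  dotv (x *m M) y = dotv x (y *m M^T).
Proof. by rewrite !dotvE trmx_mul trmxK mulmxA. Qed.

Lemma dotv_ge0 n (x : 'rV[R]_n) : 0 <= dotv x x.
Proof. by apply: sumr_ge0 => i _; rewrite -expr2 sqr_ge0. Qed.

Lemma dotv_eq0 n (x : 'rV[R]_n) : dotv x x = 0 -> x = 0.
Proof.
move=> /eqP; rewrite psumr_eq0 => [/allP x0|i _]; last by rewrite -expr2 sqr_ge0.
apply/rowP => i; have := x0 i; rewrite mem_index_enum mulf_eq0 orbb mxE.
by move=> /(_ isT)/eqP.
Qed.

Lemma enorm_ge0 n (x : 'rV[R]_n) : 0 <= enorm x.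
Proof. exact: sqrtr_ge0. Qed.

Lemma enorm_sqr n (x : 'rV[R]_n) : enorm x ^+ 2 = dotv x x.
Proof. by rewrite sqr_sqrtr// dotv_ge0. Qed.

Lemma enorm_eq0 n (x : 'rV[R]_n) : enorm x = 0 -> x = 0.
Proof. by move=> x0; apply: dotv_eq0; rewrite -enorm_sqr x0 expr0n. Qed.

Lemma enormZ n a (x : 'rV[R]_n) : enorm (a *: x) = `|a| * enorm x.
Proof.
by rewrite /enorm dotvZl dotvZr mulrA -expr2 sqrtrM ?sqr_ge0// sqrtr_sqr.
Qed.

Lemma enormN n (x : 'rV[R]_n) : enorm (- x) = enorm x.
Proof. by rewrite /enorm dotvNl dotvNr opprK. Qed.

Lemma cauchy_schwarz n (x y : 'rV[R]_n) : dotv x y <= enorm x * enorm y.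
Proof.
have [y0|y0] := eqVneq (enorm y) 0.
  by rewrite (enorm_eq0 y0) dotvC dotv0l {2}/enorm dotv0l sqrtr0 mulr0.
have [x0|x0] := eqVneq (enorm x) 0.
  by rewrite (enorm_eq0 x0) dotv0l {1}/enorm dotv0l sqrtr0 mul0r.
have := dotv_ge0 (enorm y *: x - enorm x *: y).
rewrite dotvBl !dotvBr !dotvZl !dotvZr -!enorm_sqr (dotvC y x).
have xy : 0 < enorm x * enorm y by rewrite mulr_gt0// lt_def enorm_ge0 ?x0 ?y0.
move=> h; have : 0 <= (enorm x * enorm y) * (enorm x * enorm y - dotv x y) by nra.
by rewrite pmulr_rge0// subr_ge0.
Qed.

Lemma normr_coord n (x : 'rV[R]_n) i : `|x ord0 i| <= `|x|.
Proof.
by rewrite [leRHS]mx_normrE; apply: (le_bigmax _ (fun ij => `|x ij.1 ij.2|) (ord0, i)).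
Qed.

Lemma normr_rV_le n (x : 'rV[R]_n) c : 0 <= c ->
  (forall i, `|x ord0 i| <= c) -> `|x| <= c.
Proof.
move=> c0 xc; rewrite [leLHS]mx_normrE; apply: bigmax_le => // -[i j] _ /=.
by rewrite (ord1 i).
Qed.

Lemma normr_le_enorm n (x : 'rV[R]_n) : `|x| <= enorm x.
Proof.
apply: normr_rV_le => [|i]; first exact: enorm_ge0.
rewrite -(@ler_pXn2r _ 2)// ?nnegrE ?enorm_ge0// enorm_sqr real_normK ?num_real//.
by rewrite /dotv (bigD1 i)//= expr2 lerDl sumr_ge0// => j _; rewrite -expr2 sqr_ge0.
Qed.

Lemma enorm_le_normr n (x : 'rV[R]_n) : enorm x <= n%:R * `|x|.
Proof.
rewrite -(@ler_pXn2r _ 2)// ?nnegrE ?enorm_ge0 ?mulr_ge0// enorm_sqr.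
apply: (@le_trans _ _ (\sum_(i < n) `|x| ^+ 2)).
  apply: ler_sum => i _; rewrite -expr2 -real_normK ?num_real//.
  by rewrite ler_pXn2r// ?nnegrE//; exact: normr_coord.
rewrite sumr_const card_ord -[leLHS]mulr_natl exprMn ler_wpM2r ?sqr_ge0//.
by rewrite -natrX ler_nat; case: n x => // n _; rewrite leq_pmull.
Qed.

Lemma continuous_bigsum (T : topologicalType) (I : Type) (r : seq I)
    (F : I -> T -> R) x : (forall i, {for x, continuous (F i)}) ->
  {for x, continuous (fun y => \sum_(i <- r) F i y)}.
Proof.
move=> cF; elim: r => [|i r IH].
  by rewrite (_ : (fun y => _) = cst 0); [exact: cvg_cst|apply/funext => y; rewrite big_nil].
rewrite (_ : (fun y => _) = (fun y => F i y + \sum_(j <- r) F j y)).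
  exact: (cvgD (cF i) IH).
by apply/funext => y; rewrite big_cons.
Qed.

Lemma continuous_dotv (T : topologicalType) n (f g : T -> 'rV[R]_n) x :
  {for x, continuous f} -> {for x, continuous g} ->
  {for x, continuous (fun y => dotv (f y) (g y))}.
Proof.
move=> cf cg; apply: continuous_bigsum => i.
apply: (@cvgM _ _ _ _ (fun y => f y ord0 i) (fun y => g y ord0 i)).
  apply: (@continuous_comp _ _ _ f (fun M : 'rV[R]_n => M ord0 i)) => //.
  exact: coord_continuous.
apply: (@continuous_comp _ _ _ g (fun M : 'rV[R]_n => M ord0 i)) => //.
exact: coord_continuous.
Qed.

Lemma mulmx_norm_bound m n (M : 'M[R]_(m, n)) :
  exists2 K, 0 < K & forall x : 'rV[R]_m, `|x *m M| <= K * `|x|.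
Proof.
pose K := \sum_j \sum_i `|M j i|.
have K0 : 0 <= K by apply: sumr_ge0 => j _; apply: sumr_ge0.
exists (K + 1) => [|x]; first by rewrite ltr_wpDl.
apply: normr_rV_le => [|i]; first by rewrite mulr_ge0// addr_ge0.
rewrite mxE; apply: (le_trans (ler_norm_sum _ _ _)).
apply: (@le_trans _ _ (\sum_j `|x| * \sum_i `|M j i|)).
  apply: ler_sum => j _; rewrite normrM ler_pM//; first exact: normr_coord.
  by rewrite (bigD1 i)//= lerDl sumr_ge0.
by rewrite -mulr_sumr -/K mulrC ler_wpM2r// lerDl.
Qed.

Lemma continuous_mulmx m n (M : 'M[R]_(m, n)) :
  continuous (fun x : 'rV[R]_m => x *m M).
Proof.
have [K K0 MK] := mulmx_norm_bound M.
move=> x; apply/(@cvgrPdist_le _ _ _ (nbhs x)) => e e0.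
have eK : 0 < e / K by rewrite divr_gt0.
apply: (filterS _ (nbhsx_ballx x _ eK)) => y; rewrite -ball_normE /= => xy.
rewrite -mulmxBl; apply: (le_trans (MK _)).
by rewrite mulrC -ler_pdivlMr// ltW.
Qed.

End dotv.

(** * Convexity with real weights in [0, 1] *)

Section convexity.
Context {R : realType} (n : nat).
Implicit Types (D : set 'rV[R]_n) (f : 'rV[R]_n -> R).
Local Open Scope convex_scope.

Lemma convex_setP D x y t : convex_set D -> D x -> D y -> 0 <= t <= 1 ->
  D (t *: x + (1 - t) *: y).
Proof.
move=> cD Dx Dy /andP[t0 t1]; apply/set_mem.
by apply: (cD x y (Itv01 t0 t1)); exact/mem_set.
Qed.

Lemma convex_functionP D f x y t : convex_function D f -> D x -> D y ->
  0 <= t <= 1 -> f (t *: x + (1 - t) *: y) <= t * f x + (1 - t) * f y.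
Proof.
move=> cf Dx Dy /andP[t0 t1].
by apply: (cf (Itv01 t0 t1) x y); exact/mem_set.
Qed.

Lemma convex_set_intro D :
  (forall x y t, D x -> D y -> 0 <= t <= 1 -> D (t *: x + (1 - t) *: y)) ->
  convex_set D.
Proof.
move=> cD x y l /set_mem Dx /set_mem Dy; apply/mem_set.
by apply: (cD x y l%:num) => //; rewrite ge0 le1.
Qed.

Lemma convex_function_intro D f :
  (forall x y t, D x -> D y -> 0 <= t <= 1 ->
    f (t *: x + (1 - t) *: y) <= t * f x + (1 - t) * f y) ->
  convex_function D f.
Proof.
move=> cf l x y /set_mem Dx /set_mem Dy.
by apply: (cf x y l%:num) => //; rewrite ge0 le1.
Qed.

End convexity.

(** * Contact with paraboloids *)

Section contact.
Context {R : realType} (n : nat).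
Implicit Types (D : set 'rV[R]_n).

(** [vol] is an outer measure that agrees with [lebesgue_rV] on measurable sets; the image is
    measurable because it is a preimage under the inverse map. *)
Lemma vol_affine_image (M : 'M[R]_n) (p : 'rV[R]_n) D : M \in unitmx ->
  measurable D ->
  vol ((fun x => x *m M + p) @` D) = (`|\det M|%:E * lebesgue_rV n D)%E.
Proof.
move=> uM mD.
have MD : (fun x => x *m M) @` D = (fun y => y *m invmx M) @^-1` D.
  apply/seteqP; split => [_ [x Dx <-]|y Dy] /=; first by rewrite mulmxK.
  by exists (y *m invmx M) => //; rewrite mulmxKV.
have mMD : measurable ((fun x => x *m M) @` D).
  by rewrite MD -[X in measurable X]setTI; exact: measurable_mulmxr.
have MpD : (fun x => x *m M + p) @` D =
    (fun y => y + (- p)) @^-1` ((fun x => x *m M) @` D).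
  apply/seteqP; split => [_ [x Dx <-]|y [x Dx xy]] /=.
    by rewrite addrK; exists x.
  by exists x => //; rewrite xy subrK.
have mMpD : measurable ((fun x => x *m M + p) @` D).
  rewrite MpD -[X in measurable X]setTI.
  have := @measurable_mulmx_add R n n 1%:M (- p).
  by under eq_fun do rewrite mulmx1; apply.
rewrite /vol measurable_mu_extE// MpD.
apply: (etrans (esym (lebesgue_rV_translate (- p) mMD))).
rewrite (lebesgue_rV_mulmx uM)//; congr (_ * lebesgue_rV n _)%E.
by rewrite MD; apply/seteqP; split => x /=; rewrite mulmxK.
Qed.

(* The gradients of the touching paraboloid at the points of the open set where
   it lies, lifted by eta, above u are subgradients of u there. *)
Lemma contact_det_le (Om : set 'rV[R]_n) (u : 'rV[R]_n -> R) (Lam : R)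
    (M : 'M[R]_n) (x0 p : 'rV[R]_n) (e r : R) :
  (forall A, measurable A -> A `<=` Om ->
    (MA_measure Om u A <= Lam%:E * lebesgue_rV n A)%E) ->
  convex_function Om u -> (forall x, Om x -> {for x, continuous u}) ->
  M \in unitmx -> M^T = M -> (forall z, 0 <= dotv (z *m M) z) ->
  0 < e -> 0 < r ->
  (forall x, `|x - x0| < r -> Om x /\
    u x0 + dotv p (x - x0) + 2^-1 * dotv ((x - x0) *m M) (x - x0)
      + e * `|x - x0| ^+ 2 <= u x) ->
  `|\det M| <= Lam.
Proof.
move=> MAle cu uC uM Msym Mpos e0 r0 touch.
pose q (x : 'rV[R]_n) := u x0 + dotv p (x - x0) + 2^-1 * dotv ((x - x0) *m M) (x - x0).
pose rho := r / 2.
have rho0 : 0 < rho by rewrite divr_gt0.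
have rhor : rho < r by rewrite /rho; lra.
(* Where [|x - x0| = rho], [u] exceeds [q] by at least [e * rho ^+ 2]. This lift keeps the contact
   set [D] away from there, while [x0] lies in [D]. *)
pose eta := e * rho ^+ 2.
have eta0 : 0 < eta by rewrite mulr_gt0// exprn_gt0.
pose D := [set x : 'rV[R]_n | `|x - x0| < rho /\ u x < q x + eta].
have DOm : D `<=` Om by move=> x [xr _]; apply: (touch x (lt_trans xr rhor)).1.
have subC (x : 'rV[R]_n) : {for x, continuous (fun y : 'rV[R]_n => y - x0)}.
  by apply: continuousB; [exact: cvg_id|exact: cst_continuous].
have qC (x : 'rV[R]_n) : {for x, continuous q}.
  apply: continuousD; first apply: continuousD.
  - exact: cst_continuous.
  - by apply: continuous_dotv; [exact: cst_continuous|exact: subC].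
  - apply: continuousM; first exact: cst_continuous.
    apply: continuous_dotv; last exact: subC.
    apply: (@continuous_comp _ _ _ (fun y : 'rV[R]_n => y - x0)
      (fun y : 'rV[R]_n => y *m M) x); first exact: subC.
    exact: continuous_mulmx.
have oD : open D.
  rewrite openE => x [xr ux].
  have uqC : {for x, continuous (fun y : 'rV[R]_n => q y + eta - u y)}.
    apply: continuousB; first by apply: continuousD; [exact: qC|exact: cst_continuous].
    by apply: uC; apply: DOm.
  have nC : {for x, continuous (fun y : 'rV[R]_n => rho - `|y - x0|)}.
    apply: continuousB; first exact: cst_continuous.
    exact: (cvg_norm (subC x)).
  have h1 : \forall y \near (x : 'rV[R]_n), 0 < q y + eta - u y.
    by apply: (cvgr_gt _ uqC); rewrite subr_gt0.
  have h2 : \forall y \near (x : 'rV[R]_n), 0 < rho - `|y - x0|.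
    by apply: (cvgr_gt _ nC); rewrite subr_gt0.
  near=> y; split; rewrite -subr_gt0; near: y => //.
have Dx0 : D x0.
  split; rewrite /q subrr ?normr0// mul0mx.
  by rewrite !(dotvC _ 0) !dotv0l mulr0 !addr0 ltrDl.
(* [q] is convex and its gradient at [y] is [p + (y - x0) *m M]. *)
have qtan x y : q y + dotv (p + (y - x0) *m M) (x - y) <= q x.
  have := Mpos (x - y); rewrite /q.
  have -> : x - y = (x - x0) - (y - x0) by rewrite opprB addrA subrK.
  move: (x - x0) (y - x0) => a b.
  rewrite dotvDl !(mulmxBl, dotvBl, dotvBr).
  have -> : dotv (a *m M) b = dotv (b *m M) a by rewrite dotv_mulmx Msym dotvC.
  by lra.
have sub : (fun x => x *m M + (p - x0 *m M)) @` D `<=` \bigcup_(x in D) subdiff Om u x.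
  move=> _ [x1 [x1r ux1] <-].
  have -> : x1 *m M + (p - x0 *m M) = p + (x1 - x0) *m M.
    by rewrite mulmxBl addrCA.
  set xi := p + _.
  pose K := [set x : 'rV[R]_n | `|x - x0| <= rho].
  have Kr x : K x -> `|x - x0| < r by move=> Kx; apply: (le_lt_trans Kx).
  have cK : compact K.
    apply: bounded_closed_compact.
      exists (`|x0| + rho); split; first exact: num_real.
      move=> c xc x Kx; apply: ltW; apply: le_lt_trans xc.
      rewrite -[x](subrK x0) [`|x0| + _]addrC; apply: (le_trans (ler_normD _ _)).
      by apply: lerD => //; exact: Kx.
    rewrite (_ : K = closed_ball_ Num.norm x0 rho); first exact: closed_closed_ball_.
    by apply/seteqP; split => x; rewrite /K /closed_ball_/= distrC.
  have FC : {within K, continuous (fun y : 'rV[R]_n => u y - dotv xi y)}.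
    apply: continuous_in_subspaceT => x /set_mem Kx; apply: continuousB.
      by apply: uC; apply: (touch x (Kr _ Kx)).1.
    by apply: continuous_dotv; [exact: cst_continuous|exact: cvg_id].
  have [|x2 /set_mem Kx2 x2min] := EVT_min_rV _ cK FC.
    by exists x1; exact: ltW.
  have {}x2min x : K x -> u x2 - dotv xi x2 <= u x - dotv xi x.
    by move=> Kx; apply: x2min; exact/mem_set.
  (* In [K] but outside [D], [u >= q + eta] lies above the tangent plane of [q + eta] at [x1],
     whereas [u x1] is strictly below that plane. The minimum is therefore attained in [D]. *)
  have Dx2 : D x2.
    apply: contrapT => nDx2.
    have : q x2 + eta <= u x2.
      have [x2r|x2r] := ltP `|x2 - x0| rho.
        by rewrite leNgt; apply/negP => ux2; exact: nDx2.
      have /eqP x2E : `|x2 - x0| == rho by rewrite eq_le x2r Kx2.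
      by have := (touch x2 (Kr _ Kx2)).2; rewrite x2E.
    have := qtan x2 x1; rewrite -/xi dotvBr.
    by have := x2min x1 (ltW x1r); move: ux1; lra.
  exists x2 => // y Omy; have [x2r _] := Dx2.
  (* The minimum over [K] is global by convexity: [z] lies on the segment from [x2] to [y], close
     enough to [x2] to stay in [K]. *)
  pose d := rho - `|x2 - x0|.
  have d0 : 0 < d by rewrite subr_gt0.
  have dy : 0 < d + `|y - x2| by rewrite ltr_wpDr.
  pose t := d / (d + `|y - x2|).
  have t0 : 0 < t by rewrite divr_gt0.
  have t1 : t <= 1 by rewrite ler_pdivrMr// mul1r lerDl.
  pose z := t *: y + (1 - t) *: x2.
  have zE : z - x2 = t *: (y - x2).
    by rewrite /z scalerBl scale1r scalerBr addrA addrAC addrK.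
  have Kz : K z.
    rewrite /K /=.
    rewrite (_ : z - x0 = (z - x2) + (x2 - x0)); last by rewrite addrA subrK.
    apply: (le_trans (ler_normD _ _)); rewrite zE normrZ (gtr0_norm t0) -lerBrDr -/d.
    by rewrite /t mulrAC ler_pdivrMr// ler_wpM2l ?(ltW d0)// lerDr ltW.
  have h1 := x2min z Kz.
  have h2 : u z <= t * u y + (1 - t) * u x2.
    by apply: (convex_functionP cu) => //; [exact: DOm|rewrite t1 (ltW t0)].
  have h3 : dotv xi z = dotv xi x2 + t * dotv xi (y - x2).
    by rewrite -dotvZr -zE -dotvDr addrC subrK.
  suff : 0 <= t * (u y - (u x2 + dotv xi (y - x2))) by rewrite pmulr_rge0// subr_ge0.
  by lra.
have mD := open_measurable_rV oD.
have muD0 := lebesgue_rV_open_gt0 oD Dx0.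
have muDoo : (lebesgue_rV n D < +oo)%E.
  apply: (@lebesgue_rV_bounded_lty R n D x0 rho) => // x [xr _].
  by rewrite -ball_normE /= distrC.
have : (`|\det M|%:E * lebesgue_rV n D <= Lam%:E * lebesgue_rV n D)%E.
  rewrite -(vol_affine_image (p - x0 *m M) uM mD).
  by apply: le_trans (MAle _ mD DOm); exact: le_mu_ext.
have /fineK <- : lebesgue_rV n D \is a fin_num by rewrite ge0_fin_numE.
rewrite -!EFinM lee_fin ler_pM2r// fine_gt0//.
by rewrite muD0 muDoo.
Unshelve. all: by end_near. Qed.

End contact.

(** * Subgradients and supporting hyperplanes *)

Section hahn_banach.
Context {R : realType} (n : nat).
Implicit Types (p q : 'rV[R]_n -> R).

Definition sublinear p := (forall x y, p (x + y) <= p x + p y) /\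
  (forall t x, 0 <= t -> p (t *: x) <= t * p x).

Lemma sublinear0 p : sublinear p -> p 0 = 0.
Proof.
move=> [pD pZ]; apply/eqP; rewrite eq_le.
have := pZ 0 0 (lexx _); rewrite scaler0 mul0r => -> /=.
by have := pD 0 0; rewrite addr0 -lerBlDl subrr.
Qed.

Lemma sublinearZ p t x : sublinear p -> 0 <= t -> p (t *: x) = t * p x.
Proof.
move=> sp; rewrite le_eqVlt => /predU1P[<-|t0].
  by rewrite scale0r mul0r sublinear0.
apply/eqP; rewrite eq_le sp.2 ?(ltW t0)//=.
have ti : 0 <= t^-1 by rewrite invr_ge0 ltW.
have := sp.2 _ (t *: x) ti; rewrite scalerA mulVf ?gt_eqF// scale1r.
by rewrite ler_pdivlMl.
Qed.

Lemma sublinearN p x : sublinear p -> - p (- x) <= p x.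
Proof.
by move=> sp; have := sp.1 x (- x); rewrite subrr sublinear0// -lerBlDr sub0r.
Qed.

(* q is the infimum over t >= 0 of p (x + t a) - t p a; it is linear along a. *)
Lemma sublinear_reduce p a : sublinear p ->
  exists q, [/\ sublinear q, forall x, q x <= p x & q (- a) <= - p a].
Proof.
move=> sp; pose S x := [set p (x + t *: a) - t * p a | t in [set t | 0 <= t]].
pose q x := inf (S x).
have S0 x : S x !=set0 by exists (p (x + 0 *: a) - 0 * p a); exists 0 => /=.
have Slb x : has_lbound (S x).
  exists (- p (- x)) => _ [t /= t0 <-].
  rewrite -sublinearZ// lerBrDr addrC lerBlDr.
  by have := sp.1 (x + t *: a) (- x); rewrite addrAC subrr add0r.
have qle x t : 0 <= t -> q x <= p (x + t *: a) - t * p a.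
  by move=> t0; apply: (ge_inf (Slb x)); exists t.
have qge x c : (forall t, 0 <= t -> c <= p (x + t *: a) - t * p a) -> c <= q x.
  by move=> h; apply: lb_le_inf => // _ [t /= t0 <-]; exact: h.
exists q; split; last 2 first.
- by move=> x; have := qle x 0 (lexx _); rewrite scale0r mul0r subr0 addr0.
- by have := qle (- a) 1 ler01; rewrite scale1r addNr sublinear0// mul1r sub0r.
split=> [x y|t x].
  rewrite -lerBlDr; apply: (qge) => t t0.
  rewrite lerBlDr -lerBlDl; apply: qge => s s0.
  rewrite lerBlDl; apply: (le_trans (qle _ (t + s) (addr_ge0 t0 s0))).
  have := sp.1 (x + t *: a) (y + s *: a).
  rewrite (_ : x + _ + _ = x + y + (t + s) *: a).
    by lra.
  by rewrite scalerDl addrACA.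
rewrite le_eqVlt => /predU1P[<-|t0].
  rewrite scale0r mul0r.
  by have := qle 0 0 (lexx _); rewrite scale0r mul0r subr0 addr0 (sublinear0 sp).
rewrite -ler_pdivrMl//; apply: qge => s s0; rewrite ler_pdivrMl//.
apply: (le_trans (qle _ (t * s) (mulr_ge0 (ltW t0) s0))).
by rewrite -scalerA -scalerDr (sublinearZ _ sp (ltW t0)) mulrBr mulrA.
Qed.

(** Later reductions keep what was gained along [b]: from [q <= q1 <= p] follows
    [q (- b) <= q1 (- b) <= - p b <= - q b]. *)
Lemma sublinear_reduce_seq p (s : seq 'rV[R]_n) : sublinear p ->
  exists q, [/\ sublinear q, forall x, q x <= p x &
                forall a, a \in s -> q (- a) <= - q a].
Proof.
elim: s p => [|b s IH] p sp; first by exists p.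
have [q1 [sq1 q1p q1b]] := sublinear_reduce b sp.
have [q [sq qq1 qs]] := IH q1 sq1.
exists q; split => // [x|a]; first exact: le_trans (q1p x).
rewrite inE => /predU1P[->|]; last exact: qs.
apply: (le_trans (qq1 _)); apply: (le_trans q1b); rewrite lerN2.
exact: le_trans (q1p b).
Qed.

(** Reduction along a basis makes [q] linear. The reduction along [a] comes before it, so that the
    value [p a] is retained. *)
Lemma sublinear_hahn_banach p a : sublinear p ->
  exists xi : 'rV[R]_n, (forall x, dotv xi x <= p x) /\ p a <= dotv xi a.
Proof.
move=> sp; have [q1 [sq1 q1p q1a]] := sublinear_reduce a sp.
have [q [sq qq1 qe]] :=
  sublinear_reduce_seq [seq delta_mx ord0 i | i <- enum 'I_n] sq1.
pose xi : 'rV[R]_n := \row_i q (delta_mx ord0 i).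
have qxi x : q x <= dotv xi x.
  rewrite {1}(row_sum_delta x) /dotv.
  elim/big_ind2 : _ => [|x1 x2 y1 y2 h1 h2|i _].
  - by rewrite sublinear0.
  - exact: le_trans (sq.1 _ _) (lerD h1 h2).
  - rewrite mxE mulrC; have [xi0|/ltW xi0] := leP 0 (x ord0 i); first exact: sq.2.
    move: xi0; rewrite -oppr_ge0 => xi0.
    have -> : x ord0 i *: delta_mx ord0 i =
        (- x ord0 i) *: (- delta_mx ord0 i : 'rV[R]_n).
      by rewrite scaleNr scalerN opprK.
    apply: (le_trans (sq.2 _ _ xi0)).
    rewrite -[leRHS]mulrNN ler_wpM2l//; apply: qe.
    by apply/mapP; exists i => //; rewrite mem_enum.
have xiq x : dotv xi x <= q x.
  apply: le_trans (sublinearN x sq).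
  by rewrite -[x in dotv _ x]opprK dotvNr lerN2.
exists xi; split => [x|].
  exact: le_trans (xiq x) (le_trans (qq1 x) (q1p x)).
rewrite -[a in leRHS]opprK dotvNr lerNr.
exact: le_trans (xiq _) (le_trans (qq1 _) q1a).
Qed.

Lemma open_absorbing (D : set 'rV[R]_n) x v : open D -> D x ->
  exists2 t, 0 < t & D (x + t *: v).
Proof.
move=> oD Dx; have /nbhs_ballP[r/= r0 xrD] : nbhs x D by exact: open_nbhs_nbhs.
have v1 : 0 < `|v| + 1 by rewrite ltr_wpDl.
exists (r / 2 / (`|v| + 1)); first by rewrite !divr_gt0.
apply: xrD; rewrite -ball_normE /= opprD addrA subrr sub0r normrN normrZ.
rewrite gtr0_norm ?divr_gt0// mulrAC ltr_pdivrMr//.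
have : 0 <= r * `|v| by rewrite mulr_ge0// ltW.
by lra.
Qed.

(* For h = g (x0 + _) - g x0 this yields subgradients, for h = 1, where p below
   is the gauge of D, supporting hyperplanes. *)
Lemma convex_linear_minorant (D : set 'rV[R]_n) (h : 'rV[R]_n -> R) a :
  open D -> convex_set D -> D 0 -> convex_function D h -> 0 <= h 0 ->
  exists xi : 'rV[R]_n, (forall x, D x -> dotv xi x <= h x) /\
    (forall c, (forall t, 0 < t -> D (t *: a) -> c * t <= h (t *: a)) ->
      c <= dotv xi a).
Proof.
move=> oD cD D0 ch h0.
pose S v := [set h (t *: v) / t | t in [set t | 0 < t /\ D (t *: v)]].
pose p v := inf (S v).
have abs v : exists2 t, 0 < t & D (t *: v).
  by have [t t0] := open_absorbing v oD D0; rewrite add0r; exists t.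
have S0 v : S v !=set0.
  by have [t t0 Dt] := abs v; exists (h (t *: v) / t); exists t.
(* A convex combination of [t *: v] and [r *: w] is the multiple [k] of [v + w], with
   [1 / k = 1 / t + 1 / r]; dividing by [k] turns convexity of [h] into subadditivity of [p]. *)
have comb v w t r : 0 < t -> 0 < r -> D (t *: v) -> D (r *: w) ->
    let k := t * r / (t + r) in
    [/\ 0 < k, D (k *: (v + w)) &
      h (k *: (v + w)) / k <= h (t *: v) / t + h (r *: w) / r].
  move=> t0 r0 Dv Dw k; have tr : 0 < t + r by rewrite addr_gt0.
  have k0 : 0 < k by rewrite divr_gt0// mulr_gt0.
  pose l := r / (t + r).
  have l01 : 0 <= l <= 1.
    by rewrite divr_ge0 ?(ltW r0) ?(ltW tr)//= ler_pdivrMr// mul1r lerDr ltW.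
  have E : k *: (v + w) = l *: (t *: v) + (1 - l) *: (r *: w).
    rewrite scalerDr !scalerA; congr (_ *: _ + _ *: _); rewrite /k /l; field;
      exact: lt0r_neq0.
  split => //; first by rewrite E; exact: convex_setP.
  rewrite ler_pdivrMr// E; apply: (le_trans (convex_functionP ch Dv Dw l01)).
  rewrite le_eqVlt; apply/orP; left; apply/eqP; rewrite /l /k; field.
  by rewrite !lt0r_neq0.
have Slb v : has_lbound (S v).
  have [r r0 Dr] := abs (- v).
  exists (- (h (r *: - v) / r)) => _ [t /= [t0 Dt] <-].
  have [k0 _] := comb _ _ _ _ t0 r0 Dt Dr.
  rewrite subrr scaler0 => hk.
  rewrite -subr_ge0 opprK; apply: le_trans hk.
  by rewrite divr_ge0// ltW.
have ple v t : 0 < t -> D (t *: v) -> p v <= h (t *: v) / t.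
  by move=> t0 Dt; apply: (ge_inf (Slb v)); exists t.
have pge v c : (forall t, 0 < t -> D (t *: v) -> c <= h (t *: v) / t) -> c <= p v.
  by move=> hc; apply: lb_le_inf => // _ [t /= [t0 Dt] <-]; exact: hc.
have sp : sublinear p.
  split=> [v w|t v].
    rewrite -lerBlDr; apply: (pge) => t t0 Dt.
    rewrite lerBlDr -lerBlDl; apply: pge => s s0 Ds; rewrite lerBlDl.
    have [k0 Dk] := comb _ _ _ _ t0 s0 Dt Ds.
    exact: le_trans (ple _ _ k0 Dk).
  rewrite le_eqVlt => /predU1P[<-|t0].
    (* All multiples of the zero vector lie in [D], and [h 0 / t] becomes smaller than [e] for large
       [t]. *)
    rewrite scale0r mul0r; apply/ler_addgt0Pr => e e0; rewrite add0r.
    have k0 : 0 < (`|h 0| + 1) / e by rewrite divr_gt0// ltr_wpDl.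
    apply: (le_trans (ple 0 _ k0 _)); first by rewrite scaler0.
    rewrite scaler0 invf_div mulrA ler_pdivrMr ?ltr_wpDl//.
    rewrite mulrC ler_wpM2l ?(ltW e0)//; apply: (le_trans (ler_norm _)).
    by rewrite lerDl.
  rewrite -ler_pdivrMl//; apply: pge => s s0 Ds; rewrite ler_pdivrMl//.
  have ts : 0 < s / t by rewrite divr_gt0.
  have E : (s / t) *: (t *: v) = s *: v by rewrite scalerA divfK ?gt_eqF.
  apply: (le_trans (ple _ _ ts _)); first by rewrite E.
  by rewrite E invf_div mulrCA.
have [xi [xip pxi]] := sublinear_hahn_banach a sp.
exists xi; split => [x Dx|c hc].
  apply: (le_trans (xip x)); have := ple x 1 ltr01.
  by rewrite scale1r divr1; exact.
apply: le_trans pxi; apply: pge => t t0 Dt; rewrite ler_pdivlMr//; exact: hc.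
Qed.

Lemma convex_comb_shift (x y x0 : 'rV[R]_n) t :
  t *: x + (1 - t) *: y + x0 = t *: (x + x0) + (1 - t) *: (y + x0).
Proof. by rewrite !scalerDr addrACA -scalerDl [t + _]addrC subrK scale1r. Qed.

Lemma convex_set_shift (D : set 'rV[R]_n) x0 : convex_set D ->
  convex_set [set x | D (x + x0)].
Proof.
move=> cD; apply: convex_set_intro => x y t /= Dx Dy t01.
by rewrite convex_comb_shift; exact: convex_setP.
Qed.

Lemma open_shift (D : set 'rV[R]_n) x0 : open D -> open [set x | D (x + x0)].
Proof.
move=> oD; apply: (@open_comp _ _ (fun x : 'rV[R]_n => x + x0) D) => // x _.
by apply: continuousD; [exact: cvg_id|exact: cst_continuous].
Qed.

Lemma subdiff_nonempty (D : set 'rV[R]_n) (g : 'rV[R]_n -> R) x0 :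
  open D -> convex_set D -> convex_function D g -> D x0 ->
  subdiff D g x0 !=set0.
Proof.
move=> oD cD cg Dx0.
have [|||xi [xig _]] := @convex_linear_minorant [set x | D (x + x0)]
  (fun x => g (x + x0) - g x0) 0 (open_shift oD) (convex_set_shift cD).
- by rewrite /= add0r.
- apply: convex_function_intro => x y t /= Dx Dy t01.
  rewrite convex_comb_shift.
  by have := convex_functionP cg Dx Dy t01; lra.
- by rewrite add0r subrr.
by exists xi => y Dy; have := xig (y - x0); rewrite /= subrK => /(_ Dy); lra.
Qed.

Lemma supporting_hyperplane (D : set 'rV[R]_n) c y :
  open D -> convex_set D -> D c -> ~ D y ->
  exists xi : 'rV[R]_n, (forall x, D x -> dotv xi x <= dotv xi y) /\ xi != 0.
Proof.
move=> oD cD Dc nDy.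
have [|||xi [xi1 xiy]] := @convex_linear_minorant [set x | D (x + c)]
  (cst 1) (y - c) (open_shift oD) (convex_set_shift cD).
- by rewrite /= add0r.
- by apply: convex_function_intro => x z t _ _ _; rewrite /cst; lra.
- exact: ler01.
(* If [t *: (y - c) + c] were in [D] for some [t > 1], then [y] would be in [D] as a convex
   combination of this point and [c]. *)
have {}xiy : 1 <= dotv xi (y - c).
  apply: xiy => t t0 /= Dt; rewrite mul1r leNgt; apply/negP => t1; apply: nDy.
  have -> : y = t^-1 *: (t *: (y - c) + c) + (1 - t^-1) *: c.
    rewrite scalerDr scalerA mulVf ?gt_eqF// scale1r scalerBl scale1r.
    by rewrite addrACA subrK subrr addr0.
  apply: convex_setP => //; rewrite invr_ge0 (ltW t0)/= invf_le1// ltW//.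
exists xi; split.
  move=> x Dx; have := xi1 (x - c); rewrite /= subrK => /(_ Dx).
  by move: xiy; rewrite !dotvBr /cst; lra.
by apply/eqP => xi0; move: xiy; rewrite xi0 dotv0l; lra.
Qed.

End hahn_banach.

(** * Barriers *)

Section rank_one_determinant.
Context {R : realType}.

(** [B *m U] and [U *m B] have the same determinant and are both block triangular; their diagonal
    blocks give the two sides. *)
Lemma det_1_add_rank1 n (v : 'rV[R]_n) (w : 'cV[R]_n) :
  \det (1%:M + w *m v) = 1 + (v *m w) ord0 ord0.
Proof.
pose B : 'M[R]_(1 + n) := block_mx 1%:M (- v) w 1%:M.
pose U : 'M[R]_(1 + n) := block_mx 1%:M v 0 1%:M.
have detU : \det U = 1 by rewrite det_ublock !det1 mulr1.
have BU : B *m U = block_mx 1%:M 0 w (1%:M + w *m v).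
  by rewrite mulmx_block !(mul1mx, mulmx1, mulmx0, addr0) subrr addrC.
have UB : U *m B = block_mx (1%:M + v *m w) 0 w 1%:M.
  by rewrite mulmx_block !(mul1mx, mulmx1, mul0mx, add0r) addNr.
have := congr1 determinant BU; have := congr1 determinant UB.
rewrite !det_mulmx detU mul1r mulr1 !det_lblock !det1 mulr1 mul1r => -> <-.
by rewrite [X in \det X]mx11_scalar det_scalar1 !mxE eqxx.
Qed.

(** This is the shape of the barrier's Hessian in normalised coordinates: [k] across the unit vector
    [v] and [k + a] along it. *)
Lemma det_scalar_add_rank1 n (v : 'rV[R]_n.+1) (k a : R) : k != 0 ->
  dotv v v = 1 -> \det (k%:M + a *: (v^T *m v)) = k ^+ n * (k + a).
Proof.
move=> k0 v1.
have -> : k%:M + a *: (v^T *m v) = k *: (1%:M + ((a / k) *: v^T) *m v).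
  rewrite scalerDr scalemx1 -scalemxAl scalerA; congr (_ + _ *: _).
  by rewrite mulrC divfK.
rewrite detZ det_1_add_rank1 -scalemxAr mxE -dotvE v1 mulr1 exprSr -mulrA.
by congr (_ * _); rewrite mulrDr mulr1 mulrC divfK.
Qed.

End rank_one_determinant.

Section closure_lemmas.
Context {R : realType} (n : nat).
Implicit Types (D : set 'rV[R]_n).

Lemma closure_le D (phi : 'rV[R]_n -> R) c x : continuous phi ->
  (forall x, D x -> phi x <= c) -> closure D x -> phi x <= c.
Proof.
move=> cphi phic Dx.
suff : [set y | phi y <= c] x by [].
have /closure_id -> : closed [set y | phi y <= c].
  apply: (@preimage_closed _ _ phi [set r | r <= c]); last exact: closed_le.
  by move=> y _; exact: cphi.
by move: x Dx; exact: closure_subset.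
Qed.

Lemma closure_compact D : bounded_set D -> compact (closure D).
Proof.
move=> [c [_ cD]]; apply: bounded_closed_compact; last exact: closed_closure.
exists (c + 1); split; first exact: num_real.
move=> d cd x Dx; apply: (closure_le _ _ Dx) => [y|y Dy].
  exact: norm_continuous.
by apply: cD => //; apply: lt_trans cd; rewrite ltrDl.
Qed.

Lemma within_closure_at D (u : 'rV[R]_n -> R) x : open D -> D x ->
  {within closure D, continuous u} -> {for x, continuous u}.
Proof.
move=> oD Dx cu.
have : {within D, continuous u}.
  by apply: continuous_subspaceW cu; exact: subset_closure.
by rewrite continuous_open_subspace// => /(_ x); apply; exact/mem_set.
Qed.

End closure_lemmas.

Section barrier.
Context {R : realType} (n : nat).
Local Notation V := 'rV[R]_n.+1.

(* On Om the affine map x |-> x *m A + b has values in the ball of radius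
   sqrt 2, and s, which is its component along the unit vector nu, up to an
   additive constant, lies in [0, 2]. *)
Definition normalizes (Om : set V) (A : 'M[R]_n.+1) (b nu : V) (s : V -> R) :=
  [/\ A \in unitmx, dotv nu nu = 1,
      forall x y, s y - s x = dotv nu ((y - x) *m A) &
      forall x, closure Om x ->
        dotv (x *m A + b) (x *m A + b) <= 2 /\ 0 <= s x <= 2].

Lemma normalizes_continuous Om A b nu s : normalizes Om A b nu s -> continuous s.
Proof.
move=> [_ _ sE _].
have -> : s = fun x : V => dotv nu (x *m A) + s 0.
  by apply/funext => x; have := sE 0 x; rewrite subr0 => <-; rewrite subrK.
suff h (x : V) : {for x, continuous (fun z : V => dotv nu (z *m A) + s 0)}.
  exact: h.
apply: continuousD; last exact: cst_continuous.
by apply: continuous_dotv; [exact: cst_continuous|exact: continuous_mulmx].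
Qed.

(* The barrier is g + Q, with the quadratic polynomial
   Q = 2 k (|y|^2 - 2) + a s^2 - (a h + m / h) s where y = x A + b; it is at most
   g on the boundary of Om and at most g - m on {s = h}. At a negative minimum of
   u - g - Q, g may be replaced by an affine minorant, so that u is touched from
   below by a paraboloid, whose Hessian has a determinant exceeding Lam even when
   2 k is halved; the other half makes the contact strict. *)
Lemma barrier_step (Om : set V) (A : 'M[R]_n.+1) (b nu : V) (s u g : V -> R)
    (Lam k a h m : R) :
  open Om -> bounded_set Om -> convex_set Om ->
  normalizes Om A b nu s ->
  {within closure Om, continuous u} -> {within closure Om, continuous g} ->
  convex_function Om u -> convex_function Om g ->
  (forall B, measurable B -> B `<=` Om ->
    (MA_measure Om u B <= Lam%:E * lebesgue_rV n.+1 B)%E) ->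
  (forall x, closure Om x -> ~ Om x -> u x = g x) ->
  0 < k -> 0 < a -> Lam <= \det A ^+ 2 * ((2 * k) ^+ n * (2 * a)) ->
  0 < h -> 0 <= m ->
  (forall x, closure Om x -> s x = h -> g x - m <= u x) ->
  forall t x, closure Om x -> s x <= t -> t <= h ->
    g x - (4 * k + t * (a * h + m / h)) <= u x.
Proof.
move=> oOm bOm cOm nOm uC gC cu cg MAle ug k0 a0 Lamle h0 m0 um t x Omx st th.
have sC := normalizes_continuous nOm; have [uA nu1 sE Lle] := nOm.
pose y (z : V) := z *m A + b.
pose B := a * h + m / h.
have B0 : 0 <= B by rewrite /B addr_ge0 ?divr_ge0 ?mulr_ge0 ?(ltW a0) ?(ltW h0).
pose Q (z : V) := 2 * k * (dotv (y z) (y z) - 2) + a * s z ^+ 2 - B * s z.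
have yC (x' : V) : {for x', continuous y}.
  by apply: continuousD; [exact: continuous_mulmx|exact: cst_continuous].
have QC (x' : V) : {for x', continuous Q}.
  apply: continuousB; last first.
    by apply: continuousM; [exact: cst_continuous|exact: sC].
  apply: continuousD; apply: continuousM; try exact: cst_continuous.
    apply: continuousB; last exact: cst_continuous.
    by apply: continuous_dotv; exact: yC.
  by apply: continuousM; exact: sC.
suff uQ (z : V) : closure Om z -> s z <= h -> g z + Q z <= u z.
  apply: (le_trans _ (uQ x Omx (le_trans st th))).
  rewrite -/B lerD2l /Q; have := dotv_ge0 (y x); have := sqr_ge0 (s x).
  have : B * s x <= B * t by rewrite ler_wpM2l.
  move=> h1 h2 h3.
  have h4 : 0 <= 2 * k * dotv (y x) (y x) by rewrite !mulr_ge0// ltW.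
  have h5 : 0 <= a * s x ^+ 2 by rewrite mulr_ge0// ltW.
  by lra.
move=> Omz szh; rewrite leNgt; apply/negP => uz.
pose Phi (z : V) := u z - g z - Q z.
pose K := closure Om `&` [set z : V | s z <= h].
have cK : compact K.
  apply: compact_closedI; first exact: closure_compact.
  by apply: (@preimage_closed _ _ s [set r | r <= h]); [move=> *; exact: sC|exact: closed_le].
have PhiC : {within K, continuous Phi}.
  apply: (@continuous_subspaceW _ _ K (closure Om)); first by move=> ? [].
  apply: within_continuousB; first exact: within_continuousB.
  exact: continuous_subspaceT.
have [|x0 /set_mem[Omx0 /= sx0] x0min] := EVT_min_rV _ cK PhiC; first by exists z.
have {}x0min w : closure Om w -> s w <= h -> Phi x0 <= Phi w.
  by move=> Omw sw; apply: x0min; exact/mem_set.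
have Phi0 : Phi x0 < 0.
  by apply: (le_lt_trans (x0min z Omz szh)); rewrite /Phi; lra.
have [Lx0 /andP[s0 _]] := Lle x0 Omx0.
have Lx0k : 2 * k * (dotv (y x0) (y x0) - 2) <= 0.
  by rewrite mulr_ge0_le0 ?mulr_ge0 ?(ltW k0)// subr_le0.
have mh : m / h * h = m by rewrite divfK ?gt_eqF.
have Dx0 : Om x0.
  apply: contrapT => nOmx0; move: Phi0; rewrite /Phi (ug x0)// subrr sub0r.
  rewrite ltrNl oppr0 ltNge => /negP; apply; rewrite /Q /B.
  have h1 : a * s x0 * (s x0 - h) <= 0.
    by rewrite mulr_ge0_le0 ?mulr_ge0 ?(ltW a0)// subr_le0.
  have h2 : 0 <= m / h * s x0 by rewrite mulr_ge0 ?divr_ge0 ?(ltW h0).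
  by lra.
have sx0h : s x0 < h.
  rewrite lt_neqAle sx0 andbT; apply/eqP => sx0E.
  have BE : B * h = a * h * h + m by rewrite /B mulrDl mh.
  have := um x0 Omx0 sx0E; move: Phi0; rewrite /Phi /Q sx0E BE.
  by lra.
have [xi xig] := subdiff_nonempty oOm cOm cg Dx0.
(* [p] is [xi] plus the gradient of [Q] at [x0]; [M] is the Hessian of [Q] with [4 * k] replaced by
   [2 * k]. *)
pose p := xi + ((4 * k) *: y x0 + (2 * a * s x0 - B) *: nu) *m A^T.
pose M := A *m ((2 * k)%:M + (2 * a) *: (nu^T *m nu)) *m A^T.
have k2 : 2 * k != 0 by rewrite gt_eqF// mulr_gt0.
have detM : \det M = \det A ^+ 2 * ((2 * k) ^+ n * (2 * k + 2 * a)).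
  by rewrite !det_mulmx det_tr det_scalar_add_rank1//; ring.
have dA2 : 0 < \det A ^+ 2.
  by rewrite lt_def sqr_ge0 andbT sqrf_eq0 -unitfE -unitmxE.
have detM0 : 0 < \det M.
  by rewrite detM mulr_gt0// mulr_gt0 ?exprn_gt0 ?addr_gt0 ?mulr_gt0.
have Mquad (w : V) : dotv (w *m M) w =
    2 * k * dotv (w *m A) (w *m A) + 2 * a * dotv nu (w *m A) ^+ 2.
  rewrite /M !mulmxA dotv_mulmx trmxK mulmxDr mul_mx_scalar dotvDl dotvZl.
  congr (_ + _); rewrite -scalemxAr dotvZl mulmxA; congr (_ * _).
  rewrite [w *m A *m nu^T]mx11_scalar mul_scalar_mx dotvZl -dotvE.
  by rewrite (dotvC _ nu) expr2.
have [C C0 AC] := mulmx_norm_bound (invmx A).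
have znorm (w : V) : `|w| ^+ 2 <= C ^+ 2 * dotv (w *m A) (w *m A).
  rewrite -enorm_sqr -exprMn ler_pXn2r ?nnegrE ?mulr_ge0 ?enorm_ge0 ?(ltW C0)//.
  rewrite -{1}(mulmxK uA w); apply: (le_trans (AC _)).
  by rewrite ler_wpM2l ?(ltW C0)// normr_le_enorm.
(* [C] bounds the inverse of [A], so the withheld part [k |w A|^2] of the quadratic form is at least
   [e |w|^2]. *)
pose e := k / C ^+ 2.
have e0 : 0 < e by rewrite divr_gt0// exprn_gt0.
have [r r0 rball] : exists2 r, 0 < r & forall w, `|w - x0| < r -> Om w /\ s w <= h.
  have h1 : \forall w \near x0, Om w by apply: open_nbhs_nbhs.
  have h2 : \forall w \near x0, s w < h by apply: (cvgr_lt _ (sC x0)).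
  have /nbhs_ballP[r/= r0 xr] : nbhs x0 [set w | Om w /\ s w < h] by exact: filterI.
  exists r => // w wr; have [|Omw sw] := xr w; last by rewrite ltW.
  by rewrite -ball_normE /= distrC.
have : `|\det M| <= Lam.
  apply: (@contact_det_le _ _ Om u Lam M x0 p e r) => //.
  - by move=> w Omw; exact: within_closure_at uC.
  - by rewrite unitmxE unitfE gt_eqF.
  - rewrite /M !trmx_mul trmxK mulmxA; congr (_ *m _ *m _).
    by rewrite raddfD/= tr_scalar_mx linearZ/= trmx_mul trmxK.
  - move=> w; rewrite Mquad; apply: addr_ge0; apply: mulr_ge0.
    + by rewrite mulr_ge0 ?(ltW k0).
    + exact: dotv_ge0.
    + by rewrite mulr_ge0 ?(ltW a0).
    + exact: sqr_ge0.
  move=> w wr; have [Omw sw] := rball w wr; split => //.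
  have clOmw : closure Om w by exact: subset_closure.
  have h1 := x0min w clOmw sw; have h2 := xig w Omw.
  have h3 : e * `|w - x0| ^+ 2 <= k * dotv ((w - x0) *m A) ((w - x0) *m A).
    rewrite /e mulrAC ler_pdivrMr ?exprn_gt0// -mulrA ler_wpM2l ?(ltW k0)//.
    by rewrite mulrC.
  have yw : y w = y x0 + (w - x0) *m A by rewrite /y mulmxBl [RHS]addrC addrA subrK.
  have sw2 : s w = s x0 + dotv nu ((w - x0) *m A) by rewrite -sE addrC subrK.
  move: h1; rewrite /Phi /Q yw sw2 Mquad.
  rewrite {1}/p [dotv (xi + _) _]dotvDl dotv_mulmx trmxK.
  move: h2 h3; move: (w - x0) (y x0) ((w - x0) *m A) => z1 y0 zA.
  rewrite !(dotvDl, dotvDr, dotvZl) (dotvC zA y0).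
  move: (s x0) (dotv nu zA) (dotv zA zA) (dotv y0 zA) (dotv y0 y0) => *.
  by lra.
rewrite leNgt => /negP; apply; apply: (le_lt_trans Lamle).
rewrite gtr0_norm// detM ltr_pM2l// ltr_pM2l ?exprn_gt0 ?mulr_gt0//.
by rewrite ltrDr mulr_gt0.
Qed.

End barrier.

(** * Iteration of the barrier over the scales *)

Section barrier_iteration.
Context {R : realType} (n : nat).
Local Notation V := 'rV[R]_n.+1.

(** The Monge-Ampere equation enters as an upper bound on the measure. Both the solution [u] with
    boundary values [g] and the solution on the cylinder, with [g = 0], fit this setting. *)
Record comparison (Om : set V) (A : 'M[R]_n.+1) (b nu : V) (s u g : V -> R)
    (Lam : R) : Prop := Comparison {
  cmp_open : open Om;
  cmp_bounded : bounded_set Om;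
  cmp_convex : convex_set Om;
  cmp_normalizes : normalizes Om A b nu s;
  cmp_u_continuous : {within closure Om, continuous u};
  cmp_g_continuous : {within closure Om, continuous g};
  cmp_u_convex : convex_function Om u;
  cmp_g_convex : convex_function Om g;
  cmp_MA : forall B, measurable B -> B `<=` Om ->
    (MA_measure Om u B <= Lam%:E * lebesgue_rV n.+1 B)%E;
  cmp_boundary : forall x, closure Om x -> ~ Om x -> u x = g x }.

Definition lower_bound (Om : set V) (s u g : V -> R) (t m : R) :=
  forall x, closure Om x -> s x <= t -> g x - m <= u x.

Lemma expr8_large (t : R) : 0 < t -> exists N, 1 <= 8 ^+ N * t.
Proof.
move=> t0; exists (Num.bound t^-1); rewrite -ler_pdivrMr// mul1r.
apply: (le_trans (ltW (upper_nthrootP (leqnn _)))).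
by rewrite ler_pXn2r// ?nnegrE//; lra.
Qed.

Section fixed_setting.
Context (Om : set V) (A : 'M[R]_n.+1) (b nu : V) (s u g : V -> R) (Lam : R).
Context (cmp : comparison Om A b nu s u g Lam).
Local Notation lower := (lower_bound Om s u g).

(** [barrier_step] with [k = l * kappa / 2] and [a = l * j / 2]. The size [l] absorbs [Lam] and
    [\det A]; [kappa] and [j] then distribute it between the tangential directions and the normal
    one. *)
Lemma lower_bound_step l kappa j h m t :
  0 < l -> Lam <= \det A ^+ 2 * l ^+ n.+1 ->
  0 < kappa -> 0 < j -> 1 <= kappa ^+ n * j -> 0 < h -> 0 <= m -> t <= h ->
  (forall x, closure Om x -> s x = h -> g x - m <= u x) ->
  lower t (l * (2 * kappa + t * (j / 2 * h)) + t * (m / h)).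
Proof.
move=> l0 Lamle k0 j0 kj h0 m0 th um x Omx st.
have [oOm bOm cOm nOm uC gC cu cg MAle ug] := cmp.
have := @barrier_step R n Om A b nu s u g Lam (l * kappa / 2) (l * j / 2) h m
  oOm bOm cOm nOm uC gC cu cg MAle ug.
move=> /(_ _ _ _ h0 m0 um t x Omx st th) step.
apply: le_trans (step _ _ _); last 3 first.
- by rewrite !divr_gt0 ?mulr_gt0.
- by rewrite !divr_gt0 ?mulr_gt0.
- apply: (le_trans Lamle); apply: ler_wpM2l; first exact: sqr_ge0.
  have -> : (2 * (l * kappa / 2)) ^+ n * (2 * (l * j / 2)) =
      l ^+ n.+1 * (kappa ^+ n * j).
    have e2 (y : R) : 2 * (y / 2) = y by rewrite mulrC divfK ?pnatr_eq0.
    by rewrite !e2 exprMn exprSr; ring.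
  by rewrite ler_peMr ?exprn_ge0 ?(ltW l0).
rewrite le_eqVlt; apply/orP; left; apply/eqP; field.
by rewrite gt_eqF.
Qed.

Lemma lower_bound_weaken t m m' : m <= m' -> lower t m -> lower t m'.
Proof. by move=> mm' h x Omx st; apply: le_trans (h x Omx st); rewrite lerD2l lerN2. Qed.

(** Since [s <= 2], no point satisfies [s x = 3]: the step with [h = 3] and [m = 0] covers the whole
    domain and costs [2 + 9 / 2 <= 7] times [l]. *)
Lemma lower_bound_base l t :
  0 < l -> Lam <= \det A ^+ 2 * l ^+ n.+1 -> lower t (7 * l).
Proof.
move=> l0 Lamle; have [_ _ _ Lle] := cmp_normalizes cmp.
have step : lower 3 (l * (2 * 1 + 3 * (1 / 2 * 3)) + 3 * (0 / 3)).
  apply: lower_bound_step => //; first by rewrite expr1n mulr1.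
  by move=> x Omx sx; have := (Lle x Omx).2; lra.
move=> x Omx _; have [_ /andP[_ s2]] := Lle x Omx.
by apply: (lower_bound_weaken _ step) => //; lra.
Qed.

(* Apply the step with h = 8 t, kappa = t ^ al and j = t ^ (al - 2), where
   al = 2 / (n + 1), so that kappa ^ n * j = 1. *)
Lemma lower_bound_scale l t m :
  0 < l -> Lam <= \det A ^+ 2 * l ^+ n.+1 -> 0 < t -> 0 <= m ->
  lower (8 * t) m -> lower t (6 * l * t `^ (2 / n.+1%:R) + m / 8).
Proof.
move=> l0 Lamle t0 m0 low.
pose al : R := 2 / n.+1%:R.
have t8 : 0 < 8 * t by rewrite mulr_gt0.
have step := @lower_bound_step l (t `^ al) (t `^ (al - 2)) (8 * t) m t l0 Lamle.
apply: lower_bound_weaken (step _ _ _ _ _ _ _) => //.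
- rewrite -/al powRB ?(gt_eqF t0) ?implybT// powR_mulrn ?(ltW t0)//.
  rewrite le_eqVlt; apply/orP; left; apply/eqP; field.
  by rewrite gt_eqF.
- by rewrite powR_gt0.
- by rewrite powR_gt0.
- rewrite -powR_mulrn ?powR_ge0// -powRrM -powRD ?(gt_eqF t0) ?implybT//.
  rewrite (_ : _ + _ = 0) ?powRr0//.
  rewrite /al -natr1; field; apply: lt0r_neq0; have := ler0n R n; lra.
- by rewrite ler_peMl// ?(ltW t0)//; lra.
- by move=> x Omx sx; apply: low => //; rewrite sx.
Qed.

(** The barrier needs a strictly positive [l], but [Lam = 0] leads to [l = 0]. The conclusion is
    closed in [l], and any [l' > l] is admissible. *)
Lemma lower_bound_limit t c l : 0 <= c -> 0 <= l ->
  (forall l', 0 < l' -> Lam <= \det A ^+ 2 * l' ^+ n.+1 -> lower t (c * l')) ->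
  Lam <= \det A ^+ 2 * l ^+ n.+1 -> lower t (c * l).
Proof.
move=> c0 l0 low Lamle x Omx sx; rewrite leNgt; apply/negP => ux.
pose d := g x - c * l - u x.
have d0 : 0 < d by rewrite subr_gt0.
have c1 : 0 < c + 1 by rewrite ltr_wpDl.
pose l' := l + d / (c + 1).
have dc : 0 < d / (c + 1) by rewrite divr_gt0.
have := low l' (ltr_wpDl l0 dc).
have Lamle' : Lam <= \det A ^+ 2 * l' ^+ n.+1.
  apply: (le_trans Lamle); apply: ler_wpM2l; first exact: sqr_ge0.
  by rewrite ler_pXn2r// ?nnegrE ?addr_ge0 ?(ltW dc)// lerDl ltW.
move=> /(_ Lamle' x Omx sx); apply/negP; rewrite -ltNge.
have : c * (d / (c + 1)) < d by rewrite mulrA ltr_pdivrMr//; nra.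
by rewrite /l' mulrDr /d; lra.
Qed.

Lemma lower_bound_const l t :
  0 <= l -> Lam <= \det A ^+ 2 * l ^+ n.+1 -> lower t (7 * l).
Proof. by move=> l0; apply: lower_bound_limit => // l' *; exact: lower_bound_base. Qed.

Lemma lower_bound_power l t : (2 <= n)%N -> 0 <= l ->
  Lam <= \det A ^+ 2 * l ^+ n.+1 -> 0 < t ->
  lower t (12 * t `^ (2 / n.+1%:R) * l).
Proof.
move=> n2 l0 Lamle t0; apply: lower_bound_limit (Lamle) => //.
  by rewrite mulr_ge0// powR_ge0.
move=> {l0 Lamle}l l0 Lamle.
set al : R := 2 / n.+1%:R.
have al0 : 0 <= al by rewrite divr_ge0.
have al8 : 8 `^ al <= 4.
  have -> : (4 : R) = 8 `^ (2 / 3).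
    rewrite (_ : 8 = 2 `^ 3%:R); last by rewrite powR_mulrn//; ring.
    rewrite -powRrM (_ : 3%:R * (2 / 3) = 2%:R); last by field.
    by rewrite powR_mulrn//; ring.
  apply: ler_powR; first by lra.
  by rewrite /al ler_pM2l// lef_pV2 ?posrE// ler_nat.
have [N] := expr8_large t0.
elim: N t t0 => [|N IH] t t0.
  rewrite expr0 mul1r => t1; apply: lower_bound_weaken (lower_bound_base l0 Lamle).
  have := @ge0_ler_powR R al al0 1 t; rewrite !nnegrE powR1 => /(_ ler01 (ltW t0) t1).
  by move=> h; nra.
move=> Nt; have t8 : 0 < 8 * t by rewrite mulr_gt0.
have low : lower (8 * t) (12 * (8 * t) `^ al * l).
  by apply: IH => //; rewrite mulrA -exprSr.
apply: lower_bound_weaken (lower_bound_scale l0 Lamle t0 _ low).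
  rewrite -/al powRM ?(ltW t0)//; have := powR_ge0 t al.
  move: (t `^ al) (8 `^ al) al8 => T E E4 T0.
  have : E * T * l <= 4 * T * l by rewrite !ler_wpM2r// ltW.
  by lra.
by rewrite mulr_ge0 ?(ltW l0)// mulr_ge0// powR_ge0.
Qed.

(** Passing from [8 * t] to [t] adds [6 * l * t], while the claimed bound gains [28 * l * t * ln 8],
    which is larger. For [t] in [[1/8, 1]] the factor 28 gives at least [28 * (1 / 8) * 2 = 7], the
    base constant. *)
Lemma lower_bound_log l t : n = 1%N -> 0 <= l ->
  Lam <= \det A ^+ 2 * l ^+ n.+1 -> 0 < t -> t <= 1 ->
  lower t (28 * (t * (2 - ln t)) * l).
Proof.
move=> n1 l0 Lamle t0 t1.
have pos (r : R) : 0 < r -> r <= 1 -> 0 <= 28 * (r * (2 - ln r)).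
  by move=> r0 r1; rewrite !mulr_ge0// ?ltW//; have := ln_le0 r1; lra.
apply: lower_bound_limit (Lamle) => //; first exact: pos.
move=> {l0 Lamle}l l0 Lamle.
have ln8 : 7 / 8 <= ln (8 : R).
  have := @le_ln1Dx R (- (7 / 8)) ltac:(lra).
  rewrite (_ : 1 - 7 / 8 = 8^-1); last by field.
  by rewrite lnV ?posrE//; lra.
have base r : 1 / 8 <= r -> r <= 1 -> lower r (28 * (r * (2 - ln r)) * l).
  move=> r8 r1; apply: lower_bound_weaken (lower_bound_base l0 Lamle).
  have := ln_le0 r1 => h; have : 1 / 8 * 2 <= r * (2 - ln r) by nra.
  by move=> ?; nra.
have [N] := expr8_large t0.
elim: N t t0 t1 => [|N IH] t t0 t1; first by rewrite mul1r => ?; apply: base => //; lra.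
move=> Nt; have [t8|t8] := leP (1 / 8) t; first exact: base.
have t80 : 0 < 8 * t by rewrite mulr_gt0.
have t81 : 8 * t <= 1 by lra.
have low : lower (8 * t) (28 * (8 * t * (2 - ln (8 * t))) * l).
  by apply: IH => //; rewrite mulrA -exprSr.
apply: lower_bound_weaken (lower_bound_scale l0 Lamle t0 _ low).
  rewrite n1 divff ?pnatr_eq0// powRr1 ?(ltW t0)// lnM ?posrE//.
  have tl0 : 0 <= t * l by rewrite mulr_ge0 ?(ltW t0) ?(ltW l0).
  have : t * l * (7 / 8) <= t * l * ln 8 by rewrite ler_wpM2l.
  by lra.
by rewrite mulr_ge0 ?(ltW l0)// pos.
Qed.

End fixed_setting.
End barrier_iteration.

(** * Reduction to the boundary *)

Section closure_convexity.
Context {R : realType} (n : nat).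
Implicit Types (D : set 'rV[R]_n) (u : 'rV[R]_n -> R).

Lemma within_continuous_ball D u x e :
  {within D, continuous u} -> D x -> 0 < e ->
  exists2 r, 0 < r & forall y, D y -> `|y - x| < r -> `|u y - u x| < e.
Proof.
move=> /subspace_continuousP/(_ x) + Dx e0.
move=> /(_ Dx)/cvgr_dist_lt/(_ e e0); rewrite near_withinE => /nbhs_ballP[r /= r0 xr].
exists r => // y Dy yx; rewrite distrC; apply: xr => //.
by rewrite -ball_normE /= distrC.
Qed.

Lemma closure_ball D x r : closure D x -> 0 < r -> exists2 y, D y & `|y - x| < r.
Proof.
move=> Dx r0; have [y [Dy]] := Dx _ (nbhsx_ballx x r r0).
by rewrite -ball_normE /= distrC => yx; exists y.
Qed.

Lemma convex_comb_dist (x y x' y' : 'rV[R]_n) t r : 0 <= t <= 1 ->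
  `|x' - x| < r -> `|y' - y| < r ->
  `|(t *: x' + (1 - t) *: y') - (t *: x + (1 - t) *: y)| < r.
Proof.
move=> /andP[t0 t1] xx' yy'.
rewrite opprD addrACA -!scalerBr; apply: (le_lt_trans (ler_normD _ _)).
rewrite !normrZ (ger0_norm t0) ger0_norm ?subr_ge0//.
have [t2|t2] := leP t (1 / 2).
  have : (1 - t) * `|y' - y| < (1 - t) * r by rewrite ltr_pM2l//; lra.
  have : t * `|x' - x| <= t * r by rewrite ler_wpM2l// ltW.
  by lra.
have : t * `|x' - x| < t * r by rewrite ltr_pM2l//; lra.
have : (1 - t) * `|y' - y| <= (1 - t) * r by rewrite ler_wpM2l ?subr_ge0// ltW.
by lra.
Qed.

Lemma closure_convex D x y t : convex_set D -> closure D x -> closure D y ->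
  0 <= t <= 1 -> closure D (t *: x + (1 - t) *: y).
Proof.
move=> cD Dx Dy t01 B /nbhs_ballP[r /= r0 rB].
have [x' Dx' xx'] := closure_ball Dx r0; have [y' Dy' yy'] := closure_ball Dy r0.
exists (t *: x' + (1 - t) *: y'); split; first exact: convex_setP.
by apply: rB; rewrite -ball_normE /= distrC; exact: convex_comb_dist.
Qed.

(** The solution is convex on the open set, but the segments considered later end on its boundary;
    continuity on the closure bridges the two. *)
Lemma convex_function_closure D u x y t :
  {within closure D, continuous u} -> convex_set D -> convex_function D u ->
  closure D x -> closure D y -> 0 <= t <= 1 ->
  u (t *: x + (1 - t) *: y) <= t * u x + (1 - t) * u y.
Proof.
move=> cu cD cvu Dx Dy t01; apply/ler_addgt0Pr => e e0.
have e2 : 0 < e / 2 by rewrite divr_gt0.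
have Dz := closure_convex cD Dx Dy t01.
have [r1 r10 ur1] := within_continuous_ball cu Dx e2.
have [r2 r20 ur2] := within_continuous_ball cu Dy e2.
have [r3 r30 ur3] := within_continuous_ball cu Dz e2.
pose r := Num.min r3 (Num.min r1 r2).
have r0 : 0 < r by rewrite !lt_min r10 r20 r30.
have [x' Dx' xx'] := closure_ball Dx r0; have [y' Dy' yy'] := closure_ball Dy r0.
have zz' := convex_comb_dist t01 xx' yy'.
have := ur1 x' (subset_closure Dx').
have := ur2 y' (subset_closure Dy').
have := ur3 _ (subset_closure (convex_setP cD Dx' Dy' t01)).
move: xx' yy' zz'; rewrite !lt_min => /and3P[_ xx' _] /and3P[_ _ yy'] /and3P[zz' _ _].
move=> /(_ zz') h3 /(_ yy') h2 /(_ xx') h1.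
have := convex_functionP cvu Dx' Dy' t01.
move: h1 h2 h3; rewrite !ltr_distl => /andP[_ h1] /andP[_ h2] /andP[h3 _].
move=> h4; have /andP[t0 t1] := t01.
have h5 : t * u x' <= t * (u x + e / 2) by rewrite ler_wpM2l// ltW.
have h6 : (1 - t) * u y' <= (1 - t) * (u y + e / 2).
  by rewrite ler_wpM2l ?subr_ge0// ltW.
by lra.
Qed.

End closure_convexity.

Section spectral_norm.
Context {R : realType} (n : nat).
Implicit Type A : 'M[R]_n.

Lemma specnorm_le A (x : 'rV[R]_n) : enorm (x *m A) <= specnorm A * enorm x.
Proof.
have [K K0 AK] := mulmx_norm_bound A.
pose S := [set enorm (x *m A) | x in [set x : 'rV[R]_n | enorm x <= 1]].
have Sub : has_ubound S.
  exists (n%:R * K) => _ [z /= z1 <-]; apply: (le_trans (enorm_le_normr _)).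
  rewrite ler_wpM2l//; apply: (le_trans (AK _)).
  by rewrite ler_piMr ?(ltW K0)//; exact: le_trans (normr_le_enorm _) z1.
have [x0|x0] := eqVneq (enorm x) 0.
  by rewrite x0 (enorm_eq0 x0) mul0mx mulr0 /enorm dotv0l sqrtr0.
have {}x0 : 0 < enorm x by rewrite lt_def x0 enorm_ge0.
rewrite -ler_pdivrMr//; apply: (ub_le_sup Sub).
exists ((enorm x)^-1 *: x) => /=.
  by rewrite enormZ ger0_norm ?invr_ge0 ?enorm_ge0// mulVf ?gt_eqF.
by rewrite -scalemxAl enormZ ger0_norm ?invr_ge0 ?enorm_ge0// mulrC.
Qed.

End spectral_norm.

Section boundary_estimate.
Context {R : realType} (n : nat).
Local Notation V := 'rV[R]_n.+1.

Lemma specnorm_gt0 (A : 'M[R]_n.+1) : A \in unitmx -> 0 < specnorm A.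
Proof.
move=> uA; pose e : V := delta_mx ord0 ord0.
have e0 : e != 0.
  by apply/eqP => /rowP/(_ ord0); rewrite !mxE eqxx => /eqP; rewrite oner_eq0.
have enorm_gt0 (z : V) : z != 0 -> 0 < enorm z.
  by move=> z0; rewrite lt_def enorm_ge0 andbT; apply: contra z0 => /eqP/enorm_eq0 ->.
have : 0 < enorm (e *m A).
  apply: enorm_gt0; apply: contra e0 => /eqP eA.
  by rewrite -(mulmxK uA e) eA mul0mx.
move=> /lt_le_trans/(_ (specnorm_le A e)).
by rewrite pmulr_lgt0// enorm_gt0.
Qed.

(** The outer normal [xi] at [y], carried to the image and reversed, is the inner unit normal [nu].
    Thus [s] is the distance in the image to a supporting hyperplane, at most 2 because the image
    lies in the unit ball. *)
Lemma normalizes_support (Om : set V) (A : 'M[R]_n.+1) (b c y : V) :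
  open Om -> convex_set Om -> A \in unitmx -> Om c ->
  (forall x, Om x -> enorm (x *m A + b) < 1) -> closure Om y -> ~ Om y ->
  exists nu : V, normalizes Om A b nu (fun x => dotv nu ((x - y) *m A)).
Proof.
move=> oOm cOm uA Omc OmA Omy nOmy.
have [xi [xiy xi0]] := supporting_hyperplane oOm cOm Omc nOmy.
pose eta : V := - (xi *m (invmx A)^T).
have etaE (x : V) : dotv eta (x *m A) = - dotv xi x.
  by rewrite dotvNl dotv_mulmx trmxK mulmxK.
have eta0 : 0 < enorm eta.
  rewrite lt_def enorm_ge0 andbT; apply: contra xi0 => /eqP/enorm_eq0 eta0.
  apply/eqP/dotv_eq0; have := etaE xi; rewrite eta0 dotv0l => /eqP.
  by rewrite eq_sym oppr_eq0 => /eqP.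
have LC : continuous (fun x : V => dotv (x *m A + b) (x *m A + b)).
  move=> x; suff : {for x, continuous (fun x : V => dotv (x *m A + b) (x *m A + b))} by [].
  by apply: continuous_dotv; apply: continuousD;
    [exact: continuous_mulmx|exact: cst_continuous|
     exact: continuous_mulmx|exact: cst_continuous].
have L1 x : closure Om x -> dotv (x *m A + b) (x *m A + b) <= 1.
  apply: (@closure_le R _ Om (fun x : V => dotv (x *m A + b) (x *m A + b)) 1 x) => //.
  move=> z Omz; rewrite -enorm_sqr -[leRHS](expr1n _ 2).
  by rewrite ler_pXn2r ?nnegrE ?enorm_ge0// ltW// OmA.
pose nu := (enorm eta)^-1 *: eta.
have nu1 : dotv nu nu = 1.
  by rewrite dotvZl dotvZr -enorm_sqr; field; rewrite gt_eqF.
exists nu; split => // [x z|x Omx].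
  by rewrite -dotvBr -mulmxBl opprB addrA subrK.
split; first by apply: (le_trans (L1 x Omx)); lra.
apply/andP; split.
  rewrite -oppr_le0 -dotvNr.
  apply: (@closure_le R _ Om (fun z => dotv nu (- ((z - y) *m A))) 0 x) => // [z|z Omz].
    suff : {for z, continuous (fun z : V => dotv nu (- ((z - y) *m A)))} by [].
    apply: continuous_dotv; first exact: cst_continuous.
    apply: continuousN.
    apply: (@continuous_comp V V V (fun z => z - y) (fun z => z *m A) z).
      by apply: continuousB; [exact: cvg_id|exact: cst_continuous].
    exact: continuous_mulmx.
  rewrite dotvNr oppr_le0 dotvZl etaE dotvBr mulr_ge0 ?invr_ge0 ?(ltW eta0)//.
  by rewrite oppr_ge0 subr_le0 xiy.
apply: (le_trans (cauchy_schwarz _ _)).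
rewrite {1}/enorm nu1 sqrtr1 mul1r -(@ler_pXn2r _ 2)// ?nnegrE ?enorm_ge0//.
rewrite enorm_sqr.
have -> : (x - y) *m A = (x *m A + b) - (y *m A + b).
  by rewrite mulmxBl opprD addrACA subrr addr0.
have := dotv_ge0 ((x *m A + b) + (y *m A + b)).
have := L1 x Omx; have := L1 y Omy.
move: (x *m A + b) (y *m A + b) => z w.
rewrite !(dotvDl, dotvDr, dotvNl, dotvNr) (dotvC w z).
by lra.
Qed.

(* Extend the segment from x to y (where u x <= u y) to the last point y' of the
   closure; by convexity u y - u x <= u y' - u x' with x' = y' - (y - x), and
   u = g at y', while s x' is small for the supporting hyperplane at y'. *)
Lemma two_point_estimate (Om : set V) (A : 'M[R]_n.+1) (b : V) (u g : V -> R)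
    (Lam delta E : R) :
  open Om -> bounded_set Om -> convex_set Om -> A \in unitmx ->
  (forall x, Om x -> enorm (x *m A + b) < 1) ->
  {within closure Om, continuous u} -> {within closure Om, continuous g} ->
  convex_function Om u -> convex_function Om g ->
  (forall B, measurable B -> B `<=` Om ->
    (MA_measure Om u B <= Lam%:E * lebesgue_rV n.+1 B)%E) ->
  (forall x, closure Om x -> ~ Om x -> u x = g x) -> 0 <= E ->
  (forall nu s, comparison Om A b nu s u g Lam ->
    lower_bound Om s u g (specnorm A * delta) E) ->
  forall x y, closure Om x -> closure Om y -> enorm (x - y) <= delta ->
  exists x' y', [/\ closure Om x', closure Om y', enorm (x' - y') = enorm (x - y)
    & `|u x - u y| <= `|g x' - g y'| + E].
Proof.
move=> oOm bOm cOm uA OmA uC gC cu cg MAle ug E0 low x y Omx Omy.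
wlog uxy : x y Omx Omy / u x <= u y.
  move=> wlg xyd; have [uxy|/ltW uyx] := leP (u x) (u y); first exact: wlg.
  have enormC (z w : V) : enorm (z - w) = enorm (w - z) by rewrite -enormN opprB.
  have [|x' [y' [Omx' Omy' xy' uxy']]] := wlg y x Omy Omx uyx.
    by rewrite enormC.
  exists y', x'; split => //; first by rewrite enormC xy' enormC.
  by rewrite distrC [`|g y' - _|]distrC.
have [<-{y Omy uxy}|xy] := eqVneq x y => xyd.
  by exists x, x; split => //; rewrite !subrr normr0 add0r.
pose d := y - x; pose S := [set t : R | closure Om (x + t *: d)].
have d0 : 0 < `|d| by rewrite normr_gt0 subr_eq0 eq_sym.
have S1 : S 1 by rewrite /S /= scale1r addrC subrK.
have Sub : has_ubound S.
  have [c [_ cOm']] := compact_bounded (closure_compact bOm).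
  exists ((c + 1 + `|x|) / `|d|) => t St; rewrite ler_pdivlMr//.
  apply: (le_trans (ler_wpM2r (ltW d0) (ler_norm t))).
  rewrite -normrZ -[t *: d](addKr x) addrC; apply: (le_trans (ler_normB _ _)).
  by rewrite lerD2r; apply: cOm' => //; rewrite ltrDl.
have hS : has_sup S by split => //; exists 1.
pose T := sup S; have T1 : 1 <= T by exact: ub_le_sup.
have cS : closed S.
  apply: (@preimage_closed _ _ (fun t : R => x + t *: d) (closure Om));
    last exact: closed_closure.
  move=> t _; suff : (fun r : R => x + r *: d) @ t --> x + t *: d by [].
  apply: cvgD; first exact: cvg_cst.
  by apply: cvgZr_tmp; exact: cvg_id.
have ST : S T.
  rewrite (closure_id S).1// => B /nbhs_ballP[r /= r0 rB].
  have [t St tT] := sup_adherent r0 hS; exists t; split => //; apply: rB.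
  rewrite -ball_normE /= ger0_norm; first by rewrite ltrBlDr -ltrBlDl.
  by rewrite subr_ge0; exact: ub_le_sup.
have T0 : 0 < T by apply: lt_le_trans T1.
pose y' := x + T *: d; pose x' := x + (T - 1) *: d.
have Ti01 : 0 <= T^-1 <= 1 by rewrite invr_ge0 (ltW T0)/= invf_le1.
have Ti01' : 0 <= 1 - T^-1 <= 1.
  by case/andP: Ti01 => ? ?; rewrite subr_ge0 gerBl; apply/andP.
have yE : y = T^-1 *: y' + (1 - T^-1) *: x.
  rewrite /y' scalerDr scalerA mulVf ?gt_eqF// scale1r scalerBl scale1r.
  by rewrite [RHS]addrC addrA subrK /d addrC subrK.
have x'E : x' = (1 - T^-1) *: y' + (1 - (1 - T^-1)) *: x.
  rewrite subKr /y' /x' [in RHS]scalerDr scalerA mulrBl mulVf ?gt_eqF// mul1r.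
  by rewrite [in RHS]scalerBl scale1r [RHS]addrAC subrK.
have Omx' : closure Om x' by rewrite x'E; exact: closure_convex.
have nOmy' : ~ Om y'.
  move=> Omy'; have [t t0 Omt] := open_absorbing d oOm Omy'.
  have : T + t <= T.
    apply: ub_le_sup => //; rewrite /S /= scalerDl addrA.
    exact: subset_closure.
  by rewrite leNgt ltrDl t0.
have xy'E : x' - y' = x - y.
  by rewrite /x' /y' opprD addrACA subrr add0r -scalerBl addrAC subrr add0r scaleN1r opprB.
have [c Omc] : exists c, Om c.
  by have [c Omc _] := closure_ball Omx ltr01; exists c.
have [nu nuP] := normalizes_support oOm cOm uA Omc OmA ST nOmy'.
have sx' : dotv nu ((x' - y') *m A) <= specnorm A * delta.
  have [_ nu1 _ _] := nuP.
  apply: (le_trans (cauchy_schwarz _ _)).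
  rewrite {1}/enorm nu1 sqrtr1 mul1r; apply: (le_trans (specnorm_le _ _)).
  by rewrite xy'E ler_wpM2l// ltW// specnorm_gt0.
have cmp : comparison Om A b nu (fun z => dotv nu ((z - y') *m A)) u g Lam by [].
have ux' := low nu _ cmp x' Omx' sx'.
exists x', y'; split => //; first by rewrite xy'E.
(* [y] and [x'] divide the segment from [x] to [y'] with complementary weights, so the two
   inequalities add up to [u y + u x' <= u y' + u x]. *)
have h1 := convex_function_closure uC cOm cu ST Omx Ti01.
have h2 := convex_function_closure uC cOm cu ST Omx Ti01'.
rewrite -/y' -yE in h1; rewrite -/y' -x'E in h2.
rewrite distrC ger0_norm ?subr_ge0// distrC.
have := ler_norm (g y' - g x'); rewrite (ug y' ST nOmy') in h1 h2.
rewrite distrC; lra.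
Qed.

End boundary_estimate.

(** * The modulus of continuity *)

Section monge_ampere_bound.
Context {R : realType} (n : nat).
Local Notation mu := (@lebesgue_rV R n).

(** With [Lam < 0] the exceptional null set would contain [Om], a nonempty open set. *)
Lemma ae_bound_nonneg (Om : set 'rV[R]_n) (f : 'rV[R]_n -> R) (Lam : R) c :
  open Om -> Om c -> {ae mu, forall x, Om x -> 0 <= f x <= Lam} -> 0 <= Lam.
Proof.
move=> oOm Omc [N [mN N0 fN]]; rewrite leNgt; apply/negP => Lam0.
have : (0 < mu Om)%E := lebesgue_rV_open_gt0 oOm Omc.
rewrite ltNge -N0 => /negP; apply; apply: le_measure; rewrite ?inE//.
  exact: open_measurable_rV.
move=> x Omx; apply: fN => /= /(_ Omx)/andP[f0 fL].
by have := le_trans f0 fL; rewrite leNgt Lam0.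
Qed.

Lemma MA_solution_le (Om : set 'rV[R]_n) (f g u : 'rV[R]_n -> R) (Lam : R) :
  open Om -> 0 <= Lam -> mu.-integrable Om (EFin \o f) ->
  {ae mu, forall x, Om x -> 0 <= f x <= Lam} -> MA_solution Om f g u ->
  forall B, measurable B -> B `<=` Om ->
    (MA_measure Om u B <= Lam%:E * mu B)%E.
Proof.
move=> oOm Lam0 /integrableP[mf _] fLam [_ _ MAE _] B mB BOm.
have mfB : measurable_fun B (EFin \o f).
  by apply: measurable_funS BOm mf; exact: open_measurable_rV.
rewrite MAE// -integral_cst//.
apply: (@le_trans _ _ (\int[mu]_(x in B) `|(f x)%:E|)%E).
  apply: (le_trans (lee_abs _)); exact: le_abse_integral.
apply: ae_ge0_le_integral => //.
- by apply: measurableT_comp => //.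
- case: fLam => N [mN N0 fN]; exists N; split => // x /= nx; apply: fN => /= h.
  apply: nx => Bx; have /andP[f0 fL] := h (BOm _ Bx).
  by rewrite lee_fin ger0_norm.
Qed.

End monge_ampere_bound.

Section error_term.
Context {R : realType} (m : nat).

(** The last factor of the estimate in dimension [m.+2], with [tau] standing for the spectral norm
    times [delta]. *)
Definition error_term (tau : R) : R :=
  if m.+2 == 2%N then let t := Num.min tau 1 in t * (1 - ln t)
  else tau `^ (2 / m.+2%:R).

Lemma error_term_ge0 tau : 0 < tau -> 0 <= error_term tau.
Proof.
move=> tau0; rewrite /error_term; case: ifP => _; last exact: powR_ge0.
have t1 : Num.min tau 1 <= 1 by rewrite ge_min lexx orbT.
rewrite mulr_ge0//; first by rewrite le_min (ltW tau0) ler01.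
by have := ln_le0 t1; lra.
Qed.

(** In the plane [28 * (2 - ln t) <= 56 * (1 - ln t)] for [t <= 1], which is the origin of 56;
    beyond [tau = 1] the constant bound [7 * l] is used. In higher dimension [12 <= 56]. *)
Lemma lower_bound_error (Om : set 'rV[R]_m.+2) A b nu s u g Lam l tau :
  comparison Om A b nu s u g Lam -> 0 <= l ->
  Lam <= \det A ^+ 2 * l ^+ m.+2 -> 0 < tau ->
  lower_bound Om s u g tau (56 * l * error_term tau).
Proof.
move=> cmp l0 Lamle tau0; rewrite /error_term; case: ifPn => m0.
  have {}m0 : m = 0%N by case: m m0.
  have [tau1|tau1] := leP tau 1; last first.
    apply: lower_bound_weaken (lower_bound_const cmp l0 Lamle).
    by rewrite ln1; lra.
  have m1 : m.+1 = 1%N by rewrite m0.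
  apply: lower_bound_weaken (lower_bound_log cmp m1 l0 Lamle tau0 tau1).
  have h := ln_le0 tau1.
  have : 0 <= tau * l * (- ln tau) by rewrite !mulr_ge0 ?(ltW tau0)// oppr_ge0.
  by lra.
have m1 : (2 <= m.+1)%N by case: m m0.
apply: lower_bound_weaken (lower_bound_power cmp m1 l0 Lamle tau0).
have : 0 <= tau `^ (2 / m.+2%:R) * l by rewrite mulr_ge0 ?powR_ge0.
by lra.
Qed.

Lemma error_term_a_low t : 0 < t -> t <= 1 -> error_term t = a_low m.+2 t.
Proof.
move=> t0 t1; rewrite /error_term /a_low; case: ifP => // _.
by rewrite gt_eqF//= (min_idPl t1).
Qed.

Lemma a_low_ge0 (t : R) : 0 <= t -> t <= 1 -> 0 <= a_low m.+2 t.
Proof.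
rewrite le_eqVlt => /predU1P[<- _|t0 t1]; last first.
  by rewrite -error_term_a_low// error_term_ge0.
by rewrite /a_low; case: ifP => _; rewrite ?eqxx// powR_ge0.
Qed.

(** In the plane put [w = t]^ (alpha - 1) >= 1[: then](1 - alpha) * - ln t = ln w <=
    w[bounds the logarithm, and]t * w = t [^ alpha]. *)
Lemma error_term_holder (alpha : R) : 0 < alpha < 1 ->
  exists beta K, [/\ Num.min alpha (2 / m.+2%:R) <= beta, 0 <= K &
    forall tau, 0 < tau -> error_term tau <= K * tau `^ beta].
Proof.
move=> /andP[al0 al1]; rewrite /error_term; case: (m.+2 == 2%N); last first.
  exists (2 / m.+2%:R), 1; split => // [|tau tau0]; last by rewrite mul1r.
  by rewrite ge_min lexx orbT.
exists alpha, (1 + (1 - alpha)^-1); split.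
- by rewrite ge_min lexx.
- by rewrite addr_ge0// invr_ge0 subr_ge0 ltW.
move=> tau tau0 /=; set t := Num.min tau 1.
have t0 : 0 < t by rewrite lt_min tau0 ltr01.
have t1 : t <= 1 by rewrite ge_min lexx orbT.
have ttau : t <= tau by rewrite ge_min lexx.
pose w := t `^ (alpha - 1).
have w0 : 0 < w by rewrite powR_gt0.
have lnw : ln w = (1 - alpha) * - ln t.
  by rewrite /w /powR gt_eqF// expRK; ring.
have ta : t `^ alpha = t * w.
  rewrite -[in t * w](@powRr1 _ t) ?(ltW t0)// -powRD ?(gt_eqF t0) ?implybT//.
  by congr (_ `^ _); ring.
have lnt : ln t <= 0 by exact: ln_le0.
have w1 : 1 <= w.
  by rewrite -ler_ln ?posrE// ln1 lnw mulr_ge0// ?oppr_ge0// subr_ge0 ltW.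
have lnw' : ln w <= w.
  by have := @le_ln1Dx R (w - 1) ltac:(lra); rewrite addrC subrK; lra.
have al10 : 0 < 1 - alpha by rewrite subr_gt0.
have h : - ln t <= (1 - alpha)^-1 * w by rewrite ler_pdivlMl// -lnw.
apply: (@le_trans _ _ ((1 + (1 - alpha)^-1) * t `^ alpha)).
  rewrite ta mulrCA ler_wpM2l ?(ltW t0)// mulrDl mul1r.
  by rewrite lerD.
rewrite ler_wpM2l ?addr_ge0 ?invr_ge0 ?(ltW al10)//.
by apply: ge0_ler_powR; rewrite ?nnegrE ?(ltW t0) ?(ltW tau0)// ltW.
Qed.

End error_term.

(** This explains the powers of [\det A] and [Lam] in the estimate: they make the determinant
    condition on [l] an equality. *)
Lemma det_scale (R : realType) n (A : 'M[R]_n.+1) (Lam : R) :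
  A \in unitmx -> 0 <= Lam ->
  \det A ^+ 2 * (`|\det A| `^ (- (2 / n.+1%:R)) * Lam `^ (n.+1%:R^-1)) ^+ n.+1 = Lam.
Proof.
move=> uA Lam0; have dA : \det A != 0 by rewrite -unitfE -unitmxE.
have nA : 0 < `|\det A| by rewrite normr_gt0.
rewrite exprMn -!(@powR_mulrn _ (_ `^ _)) ?powR_ge0// -!powRrM mulVf// powRr1//.
rewrite mulNr divfK// powRN powR_mulrn ?normr_ge0//.
rewrite -[\det A ^+ 2]real_normK ?num_real// mulrA mulfV ?mul1r//.
by rewrite expf_eq0/= gt_eqF.
Qed.

(** * The solution on the cylinder *)

Section cylinder.
Context {R : realType} (m : nat).
Local Notation n := m.+1.
Local Notation V := 'rV[R]_n.+1.
Local Notation K := (@cylinder R n).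

Let e1 : V := delta_mx ord0 ord0.

Lemma dotv_headtail (x y : V) :
  dotv x y = rV_head x * rV_head y + dotv (rV_tail x) (rV_tail y).
Proof.
rewrite /dotv big_ord_recl; congr (_ + _).
by apply: eq_bigr => i _; rewrite !mxE.
Qed.

Lemma rV_head_lin t (x y : V) :
  rV_head (t *: x + (1 - t) *: y) = t * rV_head x + (1 - t) * rV_head y.
Proof. by rewrite /rV_head !mxE. Qed.

Lemma rV_tail_lin t (x y : V) :
  rV_tail (t *: x + (1 - t) *: y) = t *: rV_tail x + (1 - t) *: rV_tail y.
Proof. by apply/rowP => i; rewrite !mxE. Qed.

Lemma dotv_convex k (x y : 'rV[R]_k) t : 0 <= t <= 1 ->
  dotv (t *: x + (1 - t) *: y) (t *: x + (1 - t) *: y) <=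
  t * dotv x x + (1 - t) * dotv y y.
Proof.
move=> /andP[t0 t1]; have : 0 <= t * (1 - t) * dotv (x - y) (x - y).
  by rewrite !mulr_ge0 ?subr_ge0// dotv_ge0.
rewrite !(dotvDl, dotvDr, dotvNl, dotvNr, dotvZl, dotvZr) (dotvC y x).
by lra.
Qed.

Lemma enorm_lt1 k (x : 'rV[R]_k) : (enorm x < 1) = (dotv x x < 1).
Proof.
rewrite -enorm_sqr -[X in _ = (_ < X)](expr1n _ 2).
by rewrite ltr_pXn2r ?nnegrE ?enorm_ge0.
Qed.

Lemma enorm_le1 k (x : 'rV[R]_k) : (enorm x <= 1) = (dotv x x <= 1).
Proof.
rewrite -enorm_sqr -[X in _ = (_ <= X)](expr1n _ 2).
by rewrite ler_pXn2r ?nnegrE ?enorm_ge0.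
Qed.

Lemma rV_head_continuous : continuous (@rV_head R n).
Proof. exact: coord_continuous. Qed.

Lemma dotv_tail_continuous :
  continuous (fun x : V => dotv (rV_tail x) (rV_tail x)).
Proof.
have -> : (fun x : V => dotv (rV_tail x) (rV_tail x)) =
    (fun x => dotv x x - rV_head x * rV_head x).
  by apply/funext => x; rewrite [dotv x x]dotv_headtail addrAC subrr add0r.
suff h (x : V) : {for x, continuous (fun x => dotv x x - rV_head x * rV_head x)}.
  exact: h.
apply: continuousB; first by apply: continuous_dotv; exact: cvg_id.
by apply: continuousM; exact: rV_head_continuous.
Qed.

Lemma cylinder_open : open K.
Proof.
rewrite (_ : K = (@rV_head R n @^-1` [set r | 0 < r]) `&`
    (@rV_head R n @^-1` [set r | r < 2]) `&`
    ((fun x : V => dotv (rV_tail x) (rV_tail x)) @^-1` [set r | r < 1])).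
  apply: openI; first apply: openI.
  - apply: (@open_comp V R^o); last exact: open_gt.
    by move=> x _; exact: rV_head_continuous.
  - apply: (@open_comp V R^o); last exact: open_lt.
    by move=> x _; exact: rV_head_continuous.
  - apply: (@open_comp V R^o); last exact: open_lt.
    by move=> x _; exact: dotv_tail_continuous.
apply/seteqP; split => x; rewrite /cylinder /= enorm_lt1.
  by move=> [/andP[]].
by move=> [[-> ->]].
Qed.

Lemma cylinder_convex : convex_set K.
Proof.
apply: convex_set_intro => x y t; rewrite /cylinder /= !enorm_lt1.
move=> [/andP[x0 x2] xt] [/andP[y0 y2] yt] t01.
have /andP[t0 t1] := t01.
have comb (a b c : R) : a < c -> b < c -> t * a + (1 - t) * b < c.
  move=> ac bc; have [->|tn] := eqVneq t 0; first by lra.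
  have tp : 0 < t by rewrite lt_def tn.
  have : t * a < t * c by rewrite ltr_pM2l.
  have : (1 - t) * b <= (1 - t) * c by rewrite ler_wpM2l ?subr_ge0// ltW.
  by lra.
rewrite rV_head_lin rV_tail_lin; split.
  apply/andP; split; last exact: comb.
  by have := comb (- rV_head x) (- rV_head y) 0; rewrite !oppr_lt0 => /(_ x0 y0); lra.
exact: le_lt_trans (dotv_convex _ _ t01) (comb _ _ _ xt yt).
Qed.

Lemma cylinder_bounded : bounded_set K.
Proof.
exists 3; split; first exact: num_real.
move=> c c3 x [/andP[x0 x2] xt]; apply: le_trans (ltW c3).
apply: (le_trans (normr_le_enorm _)).
rewrite -(@ler_pXn2r _ 2)// ?nnegrE ?enorm_ge0// enorm_sqr dotv_headtail.
move: xt; rewrite enorm_lt1 => xt.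
have : rV_head x * rV_head x <= 2 * 2 by rewrite ler_pM// ltW.
by lra.
Qed.

Lemma closure_cylinderP (x : V) :
  closure K x <-> 0 <= rV_head x <= 2 /\ enorm (rV_tail x) <= 1.
Proof.
split=> [Kx|[/andP[x0 x2] xt]].
  split.
    apply/andP; split.
      rewrite -oppr_le0; apply: (@closure_le R _ K (fun x => - rV_head x)) => //.
        suff h (z : V) : {for z, continuous (fun x => - rV_head x)} by exact: h.
        by apply: continuousN; exact: rV_head_continuous.
      by move=> z [/andP[z0 _] _]; rewrite oppr_le0 ltW.
    apply: (@closure_le R _ K (@rV_head R n)) => //.
      exact: rV_head_continuous.
    by move=> z [/andP[_ z2] _]; exact: ltW.
  rewrite enorm_le1.
  apply: (@closure_le R _ K (fun x => dotv (rV_tail x) (rV_tail x))) => //.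
    exact: dotv_tail_continuous.
  by move=> z [_]; rewrite enorm_lt1 => /ltW.
move=> B /nbhs_ballP[r /= r0 rB].
have d0 : 0 < `|e1 - x| + 1 by rewrite ltr_wpDl.
(* Moving [x] slightly towards the centre [e1] of the cylinder leads into the open cylinder. *)
pose t := Num.min 1 (r / 2 / (`|e1 - x| + 1)).
have t0 : 0 < t by rewrite lt_min ltr01 !divr_gt0.
have t1 : t <= 1 by rewrite ge_min lexx.
have e1h : rV_head e1 = 1 by rewrite /rV_head mxE !eqxx.
have e1t : rV_tail e1 = 0 by apply/rowP => i; rewrite !mxE.
exists (t *: e1 + (1 - t) *: x); split.
  rewrite /cylinder /= rV_head_lin rV_tail_lin e1h e1t scaler0 add0r; split.
    have h0 : 0 <= (1 - t) * rV_head x by rewrite mulr_ge0// subr_ge0.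
    have h2 : (1 - t) * rV_head x <= (1 - t) * 2 by rewrite ler_wpM2l// subr_ge0.
    by apply/andP; split; lra.
  rewrite enormZ ger0_norm ?subr_ge0//.
  have : (1 - t) * enorm (rV_tail x) <= (1 - t) * 1 by rewrite ler_wpM2l// subr_ge0.
  by lra.
apply: rB; rewrite -ball_normE /=.
have -> : x - (t *: e1 + (1 - t) *: x) = - (t *: (e1 - x)).
  by rewrite scalerBl scale1r scalerBr; apply/rowP => i; rewrite !mxE; ring.
rewrite normrN normrZ gtr0_norm//.
apply: (@le_lt_trans _ _ (r / 2)); last by lra.
apply: (@le_trans _ _ (r / 2 / (`|e1 - x| + 1) * `|e1 - x|)).
  by rewrite ler_wpM2r// ge_min lexx orbT.
by rewrite mulrAC ler_pdivrMr// ler_wpM2l ?lerDl// ltW// divr_gt0.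
Qed.

(** The cylinder centred at [e1] fits into the ball of radius sqrt 2 without rescaling, which is why
    [normalizes] allows the bound 2 for the squared norm. *)
Lemma normalizes_cylinder : normalizes K 1%:M (- e1) e1 (@rV_head R n).
Proof.
have e1h : rV_head e1 = 1 by rewrite /rV_head mxE !eqxx.
have e1t : rV_tail e1 = 0 by apply/rowP => i; rewrite !mxE.
split.
- exact: unitmx1.
- by rewrite dotv_headtail e1h e1t dotv0l addr0 mulr1.
- by move=> x y; rewrite mulmx1 dotv_headtail e1h e1t dotv0l addr0 mul1r /rV_head !mxE.
move=> x /closure_cylinderP[x02]; rewrite enorm_le1 => xt; split => //.
rewrite mulmx1 dotv_headtail.
have -> : rV_tail (x - e1) = rV_tail x.
  by rewrite -[RHS]subr0 -e1t; apply/rowP => i; rewrite !mxE.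
have -> : rV_head (x - e1) = rV_head x - 1 by rewrite -e1h /rV_head !mxE.
by case/andP: x02 => x0 x2; nra.
Qed.

(** [x] lies on a segment parallel to the axis joining the two flat faces, where [v] vanishes. The
    sign turns the lower bound on [v] into a bound on its absolute value. *)
Lemma cylinder_nonpos (v : V -> R) : {within closure K, continuous v} ->
  convex_function K v -> (forall x, closure K x -> ~ K x -> v x = 0) ->
  forall x, K x -> v x <= 0.
Proof.
move=> vC cv v0 x [/andP[x0 x2] xt].
have e1h : rV_head e1 = 1 by rewrite /rV_head mxE !eqxx.
have e1t : rV_tail e1 = 0 by apply/rowP => i; rewrite !mxE.
have headD (t : R) : rV_head (x + t *: e1) = rV_head x + t.
  by rewrite -[t in RHS]mulr1 -e1h /rV_head !mxE.
have tailD (t : R) : rV_tail (x + t *: e1) = rV_tail x.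
  by rewrite -[RHS]addr0 -(scaler0 _ t) -e1t; apply/rowP => i; rewrite !mxE.
pose p := x + (- rV_head x) *: e1; pose q := x + (2 - rV_head x) *: e1.
have ph : rV_head p = 0 by rewrite headD subrr.
have qh : rV_head q = 2 by rewrite headD addrC subrK.
have Kp : closure K p.
  by apply/closure_cylinderP; rewrite ph /p tailD lexx ltW// ltW.
have Kq : closure K q.
  by apply/closure_cylinderP; rewrite qh /q tailD lexx ltW// ltW.
have vp : v p = 0 by apply: v0 => // -[]; rewrite ph ltxx.
have vq : v q = 0 by apply: v0 => // -[]; rewrite qh ltxx andbF.
have t01 : 0 <= 1 - rV_head x / 2 <= 1 by apply/andP; split; lra.
have := convex_function_closure vC cylinder_convex cv Kp Kq t01.
rewrite vp vq !mulr0 addr0.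
suff <- : x = (1 - rV_head x / 2) *: p + (1 - (1 - rV_head x / 2)) *: q by [].
rewrite /p /q; move: (rV_head x) => t; apply/rowP => i; rewrite !mxE.
by field.
Qed.

Lemma cylinder_MA_le (v : V -> R) : MA_solution K (cst 1) (cst 0) v ->
  forall B, measurable B -> B `<=` K ->
    (MA_measure K v B <= 1%:E * lebesgue_rV n.+1 B)%E.
Proof.
by move=> [_ _ MAE _] B mB BK; rewrite MAE// -integral_cst.
Qed.

Lemma cylinder_comparison (v : V -> R) : MA_solution K (cst 1) (cst 0) v ->
  comparison K 1%:M (- e1) e1 (@rV_head R n) v (cst 0) 1.
Proof.
move=> sol; have [vC cv MAE v0] := sol.
split => //.
- exact: cylinder_open.
- exact: cylinder_bounded.
- exact: cylinder_convex.
- exact: normalizes_cylinder.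
- by apply: continuous_subspaceT => x; exact: cst_continuous.
- by apply: convex_function_intro => x y t _ _ _; rewrite /cst; lra.
- exact: cylinder_MA_le.
Qed.

Lemma cylinder_solution_bound (v : V -> R) (x : V) :
  MA_solution K (cst 1) (cst 0) v ->
  0 <= rV_head x <= 1 -> enorm (rV_tail x) <= 1 ->
  `|v x| <= 56 * a_low m.+2 (rV_head x).
Proof.
move=> sol /andP[x0 x1] xt; have [vC cv _ v0] := sol.
have Kx : closure K x by apply/closure_cylinderP; split => //; rewrite x0/=; lra.
have a0 := a_low_ge0 m x0 x1.
have [Kx'|nKx] := pselect (K x); last by rewrite v0// normr0 mulr_ge0.
have x0' : 0 < rV_head x by case: Kx' => /andP[].
rewrite ler0_norm; last exact: cylinder_nonpos Kx'.
have one : 1 <= \det (1%:M : 'M[R]_m.+2) ^+ 2 * 1 ^+ m.+2 by rewrite det1 !expr1n mulr1.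
have := lower_bound_error (cylinder_comparison sol) ler01 one x0' Kx (lexx _).
rewrite error_term_a_low// /cst.
by lra.
Qed.

End cylinder.

(** * Modulus and Hoelder continuity of the solution *)

Section regularity.
Context {R : realType} (m : nat).
Local Notation n := m.+2.
Local Notation V := 'rV[R]_n.
Context (Om : set V) (A : 'M[R]_n) (b : V) (f g u : V -> R) (Lam : R).

Definition error_scale : R :=
  56 * `|\det A| `^ (- (2 / n%:R)) * Lam `^ (n%:R^-1).

Lemma error_scale_ge0 : 0 <= error_scale.
Proof. by rewrite /error_scale !mulr_ge0 ?powR_ge0. Qed.

(** A statement on pairs of points serves both conclusions: suprema give the modulus, and the
    equality of the distances gives the Hoelder bound. *)
Lemma modulus_two_point (delta : R) x y :
  open Om -> bounded_set Om -> convex_set Om -> A \in unitmx ->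
  (forall x, Om x -> enorm (x *m A + b) < 1) ->
  (lebesgue_rV n).-integrable Om (EFin \o f) ->
  {ae lebesgue_rV n, forall x, Om x -> 0 <= f x <= Lam} ->
  {within closure Om, continuous g} -> convex_function (closure Om) g ->
  MA_solution Om f g u -> 0 < delta ->
  closure Om x -> closure Om y -> enorm (x - y) <= delta ->
  exists x' y', [/\ closure Om x', closure Om y', enorm (x' - y') = enorm (x - y)
    & `|u x - u y| <= `|g x' - g y'| +
        error_scale * error_term m (specnorm A * delta)].
Proof.
move=> oOm bOm cOm uA OmA intf fLam gC cg sol delta0 Omx Omy xyd.
have [uC cu _ ug] := sol.
have [c Omc] : exists c, Om c.
  by have [c Omc _] := closure_ball Omx ltr01; exists c.
have Lam0 := ae_bound_nonneg oOm Omc fLam.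
have tau0 : 0 < specnorm A * delta by rewrite mulr_gt0// specnorm_gt0.
have cg' : convex_function Om g.
  apply: convex_function_intro => z w t Omz Omw t01.
  by apply: convex_functionP => //; exact: subset_closure.
apply: (two_point_estimate oOm bOm cOm uA OmA uC gC cu cg'
  (MA_solution_le oOm Lam0 intf fLam sol) ug _ _ Omx Omy xyd).
  by rewrite mulr_ge0 ?error_scale_ge0// error_term_ge0.
move=> nu s cmp; rewrite /error_scale -[56 * _ * _]mulrA.
apply: lower_bound_error cmp _ _ tau0; first by rewrite mulr_ge0 ?powR_ge0.
by rewrite det_scale.
Qed.

Lemma solution_holder (alpha : R) :
  open Om -> bounded_set Om -> convex_set Om -> A \in unitmx ->
  (forall x, Om x -> enorm (x *m A + b) < 1) ->
  (lebesgue_rV n).-integrable Om (EFin \o f) ->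
  {ae lebesgue_rV n, forall x, Om x -> 0 <= f x <= Lam} ->
  {within closure Om, continuous g} -> convex_function (closure Om) g ->
  MA_solution Om f g u -> 0 < alpha < 1 -> holder Om alpha g ->
  holder Om (Num.min alpha (2 / n%:R)) u.
Proof.
move=> oOm bOm cOm uA OmA intf fLam gC cg sol al01 [H gH].
have [c [_ cOm']] := compact_bounded (closure_compact bOm).
pose D := Num.max 1 (n%:R * (2 * (c + 1))).
have D1 : 1 <= D by rewrite le_max lexx.
have D0 : 0 < D by apply: lt_le_trans D1.
have Ddiam x y : closure Om x -> closure Om y -> enorm (x - y) <= D.
  move=> Omx Omy; rewrite le_max; apply/orP; right.
  apply: (le_trans (enorm_le_normr _)); rewrite ler_wpM2l//.
  apply: (le_trans (ler_normB _ _)).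
  have c1 : c < c + 1 by rewrite ltrDl.
  by have := cOm' _ c1 x Omx; have := cOm' _ c1 y Omy => /=; lra.
have [beta [K [gamma_beta K0 errK]]] := error_term_holder m al01.
set gamma := Num.min _ _ in gamma_beta *.
have gamma0 : 0 < gamma.
  by rewrite lt_min divr_gt0// andbT; case/andP: al01.
have gamma_alpha : gamma <= alpha by rewrite ge_min lexx.
have weaken (delta r : R) : 0 < delta -> delta <= D -> gamma <= r ->
    delta `^ r <= D `^ (r - gamma) * delta `^ gamma.
  move=> d0 dD gr.
  have {1}-> : r = (r - gamma) + gamma by rewrite subrK.
  rewrite powRD ?(gt_eqF d0) ?implybT// ler_wpM2r ?powR_ge0//.
  by apply: ge0_ler_powR; rewrite ?subr_ge0// nnegrE ltW.
pose sA := specnorm A; have sA0 : 0 < sA by exact: specnorm_gt0.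
pose C := `|H| * D `^ (alpha - gamma) +
  error_scale * (K * (sA `^ beta * D `^ (beta - gamma))).
exists C => x y Omx Omy.
have [->|xy] := eqVneq x y.
  rewrite subrr normr0 mulr_ge0 ?powR_ge0// /C.
  by rewrite addr_ge0 ?mulr_ge0 ?powR_ge0 ?error_scale_ge0.
have d0 : 0 < enorm (x - y).
  by rewrite lt_def enorm_ge0 andbT; apply: contra xy => /eqP/enorm_eq0/eqP;
    rewrite subr_eq0.
have dD := Ddiam x y Omx Omy.
have [x' [y' [Omx' Omy' xy' uxy]]] := modulus_two_point oOm bOm cOm uA OmA intf
  fLam gC cg sol d0 Omx Omy (lexx _).
apply: (le_trans uxy); rewrite mulrDl; apply: lerD.
  apply: (le_trans (gH x' y' Omx' Omy')); rewrite xy' -mulrA.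
  apply: (@le_trans _ _ (`|H| * enorm (x - y) `^ alpha)).
    by rewrite ler_wpM2r ?powR_ge0// ler_norm.
  by rewrite ler_wpM2l// weaken.
rewrite -mulrA ler_wpM2l ?error_scale_ge0//.
apply: (le_trans (errK _ (mulr_gt0 sA0 d0))).
rewrite -mulrA ler_wpM2l// powRM ?(ltW sA0) ?(ltW d0)// -mulrA.
by rewrite ler_wpM2l ?powR_ge0// weaken.
Qed.

End regularity.

Unset Implicit Arguments.

Theorem theorem18 (R : realType) (m : nat) :
  let n := m.+2 in
  exists C : R, [/\ 0 < C,
    (forall v2 : 'rV[R]_n -> R,
      MA_solution (cylinder m.+1) (cst 1) (cst 0) v2 ->
      forall x : 'rV[R]_n, 0 <= rV_head x <= 1 -> enorm (rV_tail x) <= 1 ->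
        `|v2 x| <= C * a_low n (rV_head x)) &
    (forall (Omega : set 'rV[R]_n) (A : 'M[R]_n) (b : 'rV[R]_n)
        (f g u : 'rV[R]_n -> R) (Lambda : R),
      open Omega -> bounded_set Omega -> convex_set Omega ->
      A \in unitmx ->
      (forall x, Omega x -> enorm (x *m A + b) < 1) ->
      (lebesgue_rV n).-integrable Omega (EFin \o f) ->
      {ae lebesgue_rV n, forall x, Omega x -> 0 <= f x <= Lambda} ->
      {within closure Omega, continuous g} ->
      convex_function (closure Omega) g ->
      MA_solution Omega f g u ->
      (forall delta : R, 0 < delta ->
        (modulus Omega u delta <= modulus Omega g delta
          + (C * `|\det A| `^ (- (2 / n%:R)) * Lambda `^ (n%:R^-1)
             (* t (1 - ln t) is only nondecreasing on [0, 1] and becomes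
                negative for t > e: beyond t = 1 it is replaced by its
                running supremum, the constant 1 *)
             * (if n == 2%N
                then let t := Num.min (specnorm A * delta) 1 in t * (1 - ln t)
                else (specnorm A * delta) `^ (2 / n%:R)))%:E)%E) /\
      (forall alpha : R, 0 < alpha < 1 -> holder Omega alpha g ->
        holder Omega (Num.min alpha (2 / n%:R)) u))].
Proof.
move=> n; exists 56; split => //.
  move=> v2 sol x x01 xt; exact: cylinder_solution_bound.
move=> Om A b f g u Lam oOm bOm cOm uA OmA intf fLam gC cg sol.
split=> [delta delta0|alpha al01 gH]; last first.
  exact: (solution_holder oOm bOm cOm uA OmA intf fLam gC cg sol al01 gH).
apply: ge_ereal_sup => _ [x [y [Omx Omy xyd ->]]].
have [x' [y' [Omx' Omy' xy' uxy]]] := modulus_two_point oOm bOm cOm uA OmA intf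
  fLam gC cg sol delta0 Omx Omy xyd.
apply: (@le_trans _ _ (`|g x' - g y'|%:E +
  (error_scale A Lam * error_term m (specnorm A * delta))%:E)%E).
  by rewrite -EFinD lee_fin.
apply: leeD2r; apply: ereal_sup_ubound; exists x', y'; split => //.
by rewrite xy'.
Qed.
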